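(* Let $m\ge 1$ be an integer and let $W=A_{n-1}$ or $W=B_n$, where $n\ge 1$. Then the simplicial complex $\Delta^m_W$ is shellable.
   Context: Two diagonals of a convex polygon cross if they meet in their relative interiors. Definition of $\Delta^m_{A_{n-1}}$. Let $P$ be a convex $(mn+2)$-gon. $\Delta^m_{A_{n-1}}$ is the abstract simplicial complex whose vertices are the diagonals of $P$ that dissect $P$ into an $(mj+2)$-gon and an $(m(n-j)+2)$-gon for some $1\le j\le n-1$, and whose faces are the sets of pairwise noncrossing diagonals of this type. It is pure of dimension $n-2$. Definition of $\Delta^m_{B_n}$. Let $P$ be a centrally symmetric convex polygon with $2mn+2$ vertices labeled in anticlockwise order $1,2,\ldots,mn+1,\overline{1},\overline{2},\ldots,\overline{mn+1}$ (with the convention $\overline{\overline{i}}=i$). A $B$-diagonal of $P$ is either (i) a diameter, i.e. a diagonal joining antipodal points $i$ and $\overline{i}$ for some $1\le i\le mn+1$, or (ii) a pair of noncrossing diagonals $ij,\ \overline{i}\,\overline{j}$ for two distinct $i,j\in\{1,\ldots,mn+1,\overline{1},\ldots,\overline{mn+1}\}$ that are nonconsecutive around the boundary of $P$. Two $B$-diagonals are noncrossing if no diagonal of one crosses a diagonal of the other. $\Delta^m_{B_n}$ is the abstract simplicial complex whose vertices are the $B$-diagonals that dissect $P$ into a pair of $(mj+2)$-gons and a centrally symmetric $(2m(n-j)+2)$-gon for some $1\le j\le n$ (for $j=n$ the central polygon degenerates to a 2-gon and the $B$-diagonal is a diameter), and whose faces are the sets of pairwise noncrossing $B$-diagonals of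 this type. It is pure of dimension $n-1$. Shellable is meant in the usual sense for pure complexes: the facets can be ordered $F_1,\ldots,F_s$ so that for each $k\ge 2$ the complex of those faces of $F_k$ that are contained in some $F_l$ with $l<k$ is pure of dimension $\dim F_k-1$. *)

(* Defs.v *)
From HB Require Import structures.
From mathcomp Require Import all_boot all_order all_algebra.
Set Implicit Arguments.
Unset Strict Implicit.
Unset Printing Implicit Defensive.
Import Order.TTheory GRing.Theory Num.Theory.
Local Open Scope ring_scope.

(** * Simplicial complexes and shellability *)

Record simplicial_complex (V : finType) := SimplicialComplex {
  face :> {set V} -> Prop;
  face0 : face set0;
  faceS : forall F G : {set V}, G \subset F -> face F -> face G }.

(* [simplex_dim set0 = -1]. *)
Definition simplex_dim (V : finType) (F : {set V}) : int := #|F|%:Z - 1.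

Definition facet (V : finType) (K : {set V} -> Prop) (F : {set V}) : Prop :=
  K F /\ forall G : {set V}, K G -> F \subset G -> G = F.

Definition pure_of_dim (V : finType) (K : {set V} -> Prop) (d : int) : Prop :=
  forall F : {set V}, facet K F -> simplex_dim F = d.

(* The faces of the [k]-th term of [s] contained in an earlier term. *)
Definition earlier_faces (V : finType) (s : seq {set V}) (k : nat)
    (G : {set V}) : Prop :=
  G \subset nth set0 s k /\ exists2 l, (l < k)%N & G \subset nth set0 s l.

(* Indices start at 0, so the condition bears on [0 < k]. *)
Definition shelling (V : finType) (K : {set V} -> Prop)
    (s : seq {set V}) : Prop :=
  [/\ uniq s,
      forall F : {set V}, F \in s <-> facet K F &
      forall k, (0 < k < size s)%N ->
        pure_of_dim (earlier_faces s k) (simplex_dim (nth set0 s k) - 1)].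

(* Shellability in the sense of pure complexes: purity is part of it. *)
Definition shellable (V : finType) (K : simplicial_complex V) : Prop :=
  (exists d : int, pure_of_dim K d) /\ exists s : seq {set V}, shelling K s.

Section PairwiseComplex.
Variables (V : finType) (vertex : V -> Prop) (compatible : V -> V -> Prop).

Definition pairwise_face (F : {set V}) : Prop :=
  (forall x, x \in F -> vertex x) /\
  (forall x y, x \in F -> y \in F -> x != y -> compatible x y).

Lemma pairwise_face0 : pairwise_face set0.
Proof. by split=> x; rewrite inE. Qed.

Lemma pairwise_faceS (F G : {set V}) :
  G \subset F -> pairwise_face F -> pairwise_face G.
Proof.
move=> /subsetP GF [Fv Fc]; split=> [x /GF /Fv //|x y /GF xF /GF yF].
exact: Fc.
Qed.

Definition pairwise_complex : simplicial_complex V :=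
  SimplicialComplex pairwise_face0 pairwise_faceS.

End PairwiseComplex.

(** * Convex polygons *)

Section Polygon.
Variables (R : realFieldType) (N : nat).
Implicit Types (P : 'I_N -> 'rV[R]_2) (i j k : 'I_N) (d e : {set 'I_N}).

(* Twice the signed area of the triangle [a b c]. *)
Definition orientation (a b c : 'rV[R]_2) : R :=
  (b 0 0 - a 0 0) * (c 0 1 - a 0 1) - (b 0 1 - a 0 1) * (c 0 0 - a 0 0).

(* [P 0, ..., P N.-1] are the vertices of a (strictly) convex polygon, listed
   anticlockwise. *)
Definition convex_polygon P : Prop :=
  forall i j k, (i < j < k)%N -> 0 < orientation (P i) (P j) (P k).

Definition consecutive i j : bool := (j == ordS i) || (i == ordS j).

(* A diagonal is represented by the set of its two endpoints. *)
Definition is_diagonal i j : bool := (i != j) && ~~ consecutive i j.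

Definition in_relint P d (x : 'rV[R]_2) : Prop :=
  exists i j, [/\ d = [set i; j], i != j &
    exists2 t : R, 0 < t < 1 & x = (1 - t) *: P i + t *: P j].

Definition cross P d e : Prop :=
  exists2 x, in_relint P d x & in_relint P e x.

(* Number of boundary edges traversed going anticlockwise from [i] to [k]. *)
Definition steps i k : nat := ((k + (N - i)) %% N)%N.

(* The vertices met going anticlockwise from [i] to [j], both included.  The
   diagonal [i j] dissects the polygon into the polygons with vertex sets
   [boundary_arc i j] and [boundary_arc j i]. *)
Definition boundary_arc i j : {set 'I_N} := [set k | (steps i k <= steps i j)%N].

(* Used for even [N] only. *)
Definition antipode i : 'I_N := iter N./2 (@ordS N) i.

Definition centrally_symmetric P : Prop :=
  exists c : 'rV[R]_2, forall i, P (antipode i) - c = - (P i - c).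

(* A B-diagonal is represented by its set of one or two diagonals. *)
Definition diagonal_pair i j : {set {set 'I_N}} :=
  [set [set i; j]; [set antipode i; antipode j]].

Definition is_B_diagonal P (D : {set {set 'I_N}}) : Prop :=
  (exists i, D = [set [set i; antipode i]]) \/
  (exists i j, [/\ is_diagonal i j,
     ~ cross P [set i; j] [set antipode i; antipode j] &
     D = diagonal_pair i j]).

Definition B_noncrossing P (D E : {set {set 'I_N}}) : Prop :=
  forall d e, d \in D -> e \in E -> ~ cross P d e.

End Polygon.

(** * The complexes of type A and B *)

Section Complexes.
Variables (R : realFieldType) (m n : nat).

Definition A_vertex (d : {set 'I_(m * n + 2)}) : Prop :=
  exists i j, [/\ is_diagonal i j, d = [set i; j] &
    exists2 k, (1 <= k <= n - 1)%N &
      #|boundary_arc i j| = (m * k + 2)%N /\ #|boundary_arc j i| = (m * (n - k) + 2)%N].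

Definition Delta_A (P : 'I_(m * n + 2) -> 'rV[R]_2) :
    simplicial_complex {set 'I_(m * n + 2)} :=
  pairwise_complex A_vertex (fun d e => ~ cross P d e).

(* The diagonals [i j] and [antipode i, antipode j] cut off the polygons
   [boundary_arc i j] and [boundary_arc (antipode i) (antipode j)]; the central polygon consists
   of the vertices on the other side of both.  For a diameter, where
   [j = antipode i], the latter is [[set i; j]]. *)
Definition B_vertex (P : 'I_(2 * m * n + 2) -> 'rV[R]_2)
    (D : {set {set 'I_(2 * m * n + 2)}}) : Prop :=
  is_B_diagonal P D /\
  exists i j, D = diagonal_pair i j /\
    exists2 k, (1 <= k <= n)%N &
      [/\ #|boundary_arc i j| = (m * k + 2)%N,
          #|boundary_arc (antipode i) (antipode j)| = (m * k + 2)%N &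
          #|boundary_arc j i :&: boundary_arc (antipode j) (antipode i)| =
            (2 * m * (n - k) + 2)%N].

Definition Delta_B (P : 'I_(2 * m * n + 2) -> 'rV[R]_2) :
    simplicial_complex {set {set 'I_(2 * m * n + 2)}} :=
  pairwise_complex (B_vertex P) (B_noncrossing P).

End Complexes.

Arguments Delta_A {R} m n P.
Arguments Delta_B {R} m n P.

(* Main.v *)
Require Import Defs.
From HB Require Import structures.
From mathcomp Require Import all_boot all_order all_algebra.
From mathcomp Require Import zify ring lra boolp.
Set Implicit Arguments.
Unset Strict Implicit.
Unset Printing Implicit Defensive.
Import Order.TTheory GRing.Theory Num.Theory.
Local Open Scope ring_scope.

(** Put M = m n + 1.  Both complexes are governed by arcs (a, b) of the integer
    interval [0, M] with b - a > 1 and b - a = 1 modulo m, two arcs crossing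
    when their endpoints interleave strictly.  The arc (0, M), called the root
    below, crosses no other arc.  For type A the other arcs are the diagonals
    that occur in the polygon with vertices 0, ..., M, the root is one of its
    edges, and a facet together with the root is a maximal set of pairwise
    noncrossing arcs.  For
    type B an arc of the integers of length at most M, taken up to translation
    by M, is a B-diagonal, the antipodal map being the translation by M on the integers
    modulo 2M.  The B-diagonals that do not cross a diameter (p, p + M) are
    represented in [p, p + M], so the facets containing this diameter are the
    maximal noncrossing sets of arcs of that interval, and the diameter is
    their root.  Every facet contains a diameter: the one that starts where a
    longest arc of the facet starts crosses nothing ([compatible_diameter]).
    The passage from crossing segments to interleaving endpoints is the sign
    of the orientation of three vertices in convex position ([crossE]).

    The shelling sorts the facets by a key.  What is needed
    ([shellable_of_key]) is that for two facets F <> G with key F <= key G some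
    d in G but not in F can be exchanged for another vertex so that the result
    is a facet of smaller key.  Such exchanges also yield purity: descending
    along them from any facet ends at the first one, and they preserve the
    number of vertices.

    The exchange for arcs is [exists_flip].  Let (x, y) be an arc of a maximal
    noncrossing set g, with x > 0, that is the longest one starting at x.  Let
    v be the leftmost point joined to x by an arc of g or by a unit step, and
    u the leftmost point after x joined to y in the same way.  Then (x, y) can
    be replaced by (v, u).  The gap of (v, u) is right because
    u - v = (x - v) + (y - x) - (y - u), and the new set is maximal by the same
    computation: an arc that is compatible with the new set but crosses (x, y)
    would, combined with the arcs at hand, produce an arc of g that contradicts
    the choice of v, of u, or of (x, y).  Since u < y, these exchanges lower
    right endpoints, so that sets of arcs are compared lexicographically by
    right endpoints, larger ones first ([weight]).  If (x, y) is the highest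
    arc where F and G differ and lies in G, then it satisfies the hypotheses
    of the exchange ([exists_flip_of_top]): some arc of F crosses (x, y), it
    starts to the left of x because the higher arcs are those of G, and it
    would cross any longer arc of G starting at x, which belongs to F too.

    This settles type A, and pairs of facets of type B with a common diameter.
    Facets of type B are compared first by the origin p < M of their diameter.
    If the diameter of F starts at q < p, where p is the origin for G, let
    (a, M) be the last side of the cell of G under its root, in coordinates
    relative to p.  The root may be replaced by the diameter starting at p + a
    ([exists_root_flip]).  If p + a >= M, this diameter starts at p + a - M < p
    and the key decreases.  Otherwise (p + a, p + M) crosses the diameter of F,
    hence is not in F, and it is exchanged by [exists_flip]. *)

Local Open Scope nat_scope.

(** * Maximal systems of noncrossing arcs *)

Definition crossing (a b c d : nat) : Prop :=
  a < c /\ c < b /\ b < d \/ c < a /\ a < d /\ d < b.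

Lemma crossing_irr a b : ~ crossing a b a b.
Proof. by rewrite /crossing; lia. Qed.

Section ArcSystems.
Variables m M : nat.
Implicit Types f g : nat -> nat -> Prop.

(** For [a < b] this is b - a = 1 modulo m: a chord with this gap cuts off a
    polygon with m k + 2 vertices for some k. *)
Definition good_gap a b := m %| b - a - 1.

Lemma good_gapS a : good_gap a a.+1.
Proof. by rewrite /good_gap subSnn subnn dvdn0. Qed.

(** A sum of two good gaps minus a third one is good; [t - s] is that
    combination, written without subtraction. *)
Lemma good_gap_exchange a b c d a' b' s t :
    good_gap a b -> good_gap c d -> good_gap a' b' ->
    a < b -> c < d -> a' < b' -> s < t -> t + a + c + b' = b + d + a' + s ->
  good_gap s t.
Proof.
rewrite /good_gap => h1 h2 h3 l1 l2 l3 l4 e.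
rewrite (_ : t - s - 1 = b - a - 1 + (d - c - 1) - (b' - a' - 1)); last first.
  by clear -l1 l2 l3 l4 e; lia.
by rewrite dvdn_sub ?dvdn_add.
Qed.

Lemma good_gap_eq a b c d : good_gap a b -> b - a = d - c -> good_gap c d.
Proof. by rewrite /good_gap => h <-. Qed.

Lemma good_gapP a b : a < b -> good_gap a b -> exists k, b = a + (m * k + 1).
Proof.
by move=> ab /dvdnP [k e]; exists k; rewrite mulnC -e; clear -ab; lia.
Qed.

Lemma good_gap_mul a k : good_gap a (a + (m * k + 1)).
Proof. by rewrite /good_gap addKn addnK dvdn_mulr. Qed.

Definition admissible a b : Prop := [/\ a.+1 < b, b <= M & good_gap a b].

(** Maximality makes the root (0, M) a member as soon as it is admissible. *)
Definition max_system g : Prop :=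
  [/\ forall a b, g a b -> admissible a b,
      forall a b c d, g a b -> g c d -> ~ crossing a b c d
    & forall a b, admissible a b ->
        (forall c d, g c d -> ~ crossing a b c d) -> g a b].

Lemma eq_max_system f g :
  (forall a b, f a b <-> g a b) -> max_system f -> max_system g.
Proof.
move=> fg [fadm fnc fmax]; split.
- by move=> a b /fg; apply: fadm.
- by move=> a b c d /fg fab /fg; apply: fnc.
by move=> a b aab nc; apply/fg/fmax => // c d /fg; apply: nc.
Qed.

Definition replace_arc g (x y v u a b : nat) : Prop :=
  g a b /\ (a, b) <> (x, y) \/ (a, b) = (v, u).

(** In the dissection by [g], [v] and [u] are neighbours of [x] and [y] in the
    two cells adjacent to the arc (x, y): (v, x) is a side of the cell above it
    and (u, y) one of the cell below it.  The two cells merge into a cell with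
    2m + 2 vertices, of which (v, u) is another diagonal. *)
Lemma exists_flip g x y : max_system g -> g x y -> 0 < x ->
    (forall z, g x z -> z <= y) ->
  exists v u, [/\ v < x, x < u, u < y & max_system (replace_arc g x y v u)].
Proof.
move=> [gadm gnc gmax] gxy x_gt0 xlast.
have [xy yM dxy] := gadm _ _ gxy.
have exv : exists v, (v == x.-1) || `[< g v x >] by exists x.-1; rewrite eqxx.
have exu : exists u, (x < u) && ((u == y.-1) || `[< g u y >]).
  by exists y.-1; rewrite eqxx andbT; clear -xy; lia.
case: (ex_minnP exv) => v vP vmin; case: (ex_minnP exu) => u /andP [xu uP] umin.
have {exv vmin} vmin a : g a x -> v <= a.
  by move=> h; apply: vmin; apply/orP; right; apply/asboolP.
have {exu umin} umin a : x < a -> g a y -> u <= a.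
  by move=> xa h; apply: umin; rewrite xa; apply/orP; right; apply/asboolP.
have {}vP : v.+1 = x \/ g v x.
  by case/orP: vP => [/eqP ->|/asboolP]; [left; rewrite prednK|right].
have {}uP : u.+1 = y \/ g u y.
  case/orP: uP => [/eqP ->|/asboolP]; [left; rewrite prednK //|by right].
  by clear -xy; lia.
have vx : v < x by case: vP => [<-//|/gadm [h _ _]]; exact: ltnW.
have uy : u < y by case: uP => [<-//|/gadm [h _ _]]; exact: ltnW.
have dvx : good_gap v x by case: vP => [<-|/gadm []//]; exact: good_gapS.
have duy : good_gap u y by case: uP => [<-|/gadm []//]; exact: good_gapS.
have ncv a b : (g v x -> ~ crossing a b v x) -> ~ crossing a b v x.
  case: vP => [e _|h /(_ h) //]; rewrite /crossing; clear -e; lia.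
have ncu a b : (g u y -> ~ crossing a b u y) -> ~ crossing a b u y.
  case: uP => [e _|h /(_ h) //]; rewrite /crossing; clear -e; lia.
(* The gaps satisfy u - v = (x - v) + (y - x) - (y - u). *)
have avu : admissible v u.
  split; [clear -vx xu; lia|clear -uy yM; lia|].
  by apply: (good_gap_exchange dvx dxy duy); clear -vx xu xy uy; lia.
have nc_new a b : g a b -> (a, b) <> (x, y) -> ~ crossing a b v u.
  move=> gab ne.
  have h1 := ncv a b (fun h => gnc _ _ _ _ gab h).
  have h2 := ncu a b (fun h => gnc _ _ _ _ gab h).
  have h3 := gnc _ _ _ _ gab gxy.
  have h4 : b = x -> v <= a by move=> e; apply: vmin; rewrite -e.
  have h5 : b = y -> x < a -> u <= a by move=> e xa; apply: umin; rewrite -?e.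
  have h6 : a = x -> b <= y by move=> e; apply: xlast; rewrite -e.
  have h7 : a = x -> b <> y by move=> ea eb; apply: ne; rewrite ea eb.
  have [ab _ _] := gadm _ _ gab.
  by move: h1 h2 h3; rewrite /crossing; clear -h4 h5 h6 h7 ab vx xu uy xy; lia.
exists v, u; split => //; split.
- by move=> a b [[/gadm //] | [-> ->]].
- move=> a b c d [[gab ne]|[-> ->]] [[gcd ne']|[-> ->]].
  + exact: gnc.
  + exact: nc_new.
  + by have := nc_new _ _ gcd ne'; rewrite /crossing; clear; lia.
  + by rewrite /crossing; clear; lia.
move=> a b aab ncab.
have nc_g c d : g c d -> c <> x \/ d <> y -> ~ crossing a b c d.
  move=> gcd ne; apply: ncab; left; split=> // -[ec ed].
  by case: ne.
have nc_vu : ~ crossing a b v u by apply: ncab; right.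
have [[ea eb]|ne] := pselect ((a, b) = (x, y)).
  by move: nc_vu; rewrite ea eb /crossing; clear -vx xu uy; lia.
have [ab bM dab] := aab.
(* An arc that does not cross (x, y) already belongs to [g]; one that does is
   shown to be (v, u). *)
have [cr|ncr] := pselect (crossing a b x y); last first.
  left; split => //; apply: gmax => // c d gcd.
  by have [[-> ->]|ne'] := pselect ((c, d) = (x, y)); last by apply: ncab; left.
right.
have h1 : ~ crossing a b v x by apply: ncv => h; apply: nc_g h _; left; clear -vx; lia.
have h2 : ~ crossing a b u y by apply: ncu => h; apply: nc_g h _; left; clear -xu; lia.
have [[ax xb ltb]|[xa ay yb]] : [/\ a < x, x < b & b < y] \/ [/\ x < a, a < y & y < b].
  by case: cr => [[? [? ?]]|[? [? ?]]]; [left|right].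
- have [la lb] : a <= v /\ b <= u.
    by move: h1 h2; rewrite /crossing; clear -ax xb ltb vx xu uy; lia.
  have [eav|nav] := eqVneq a v; have [ebu|nbu] := eqVneq b u.
  + by rewrite eav ebu.
  + (* An arc of [g] crossing (b, y) would cross (v, b) or (x, y). *)
    have gby : g b y.
      apply: gmax => [|c d gcd].
        split; [clear -lb nbu uy; lia|exact: yM|].
        by apply: (good_gap_exchange dvx dxy dab); clear -eav vx xy ab ltb; lia.
      have e1 := nc_g _ _ gcd; have e2 := gnc _ _ _ _ gcd gxy.
      by move: e1 e2; rewrite /crossing; clear -ax xb ltb; lia.
    by have := umin b xb gby; clear -lb nbu; lia.
  + (* An arc of [g] crossing (a, x) would cross (a, u) or (x, y). *)
    have gax : g a x.
      apply: gmax => [|c d gcd].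
        split; [clear -la nav vx; lia|clear -xy yM; lia|].
        by apply: (good_gap_exchange dab duy dxy); clear -ebu ax xy ab uy; lia.
      have e1 := nc_g _ _ gcd; have e2 := gnc _ _ _ _ gcd gxy.
      by move: e1 e2; rewrite /crossing; clear -ax xb ltb; lia.
    by have := vmin _ gax; clear -la nav; lia.
  + by case: nc_vu; left; clear -la nav lb nbu xb vx; lia.
- have eau : a = u.
    by move: h2 nc_vu; rewrite /crossing; clear -xa ay yb vx uy; lia.
  (* An arc of [g] crossing (x, b) would cross (u, b) or (x, y). *)
  have gxb : g x b.
    apply: gmax => [|c d gcd].
      split; [clear -xy yb; lia|exact: bM|].
      by apply: (good_gap_exchange dab dxy duy); clear -eau xy yb ab uy; lia.
    have e1 := nc_g _ _ gcd; have e2 := gnc _ _ _ _ gcd gxy.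
    by move: e1 e2; rewrite /crossing; clear -xa ay yb; lia.
  by have := xlast _ gxb; clear -yb; lia.
Qed.

(** The form in which flips are used: (x, y) is the arc with the highest right
    endpoint on which [f] and [g] differ.  By maximality some arc (c, d) of [f]
    crosses (x, y).  Here d < y, since otherwise (c, d) is in [g]; thus
    0 <= c < x, and an arc (x, z) of [g] with z > y is in [f] but crosses
    (c, d). *)
Lemma exists_flip_of_top f g x y : max_system f -> max_system g ->
    g x y -> ~ f x y -> (forall a b, y < b -> f a b <-> g a b) ->
  exists v u, [/\ v < x, x < u, u < y & max_system (replace_arc g x y v u)].
Proof.
move=> [fadm fnc fmax] gM gxy nfxy eqfg; have [gadm gnc _] := gM.
have axy := gadm _ _ gxy.
have [c [d [fcd cr]]] : exists c d, f c d /\ crossing x y c d.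
  apply: contrapT => nex; apply: nfxy; apply: fmax => // c d fcd cr.
  by apply: nex; exists c, d.
have dy : d <= y.
  rewrite leqNgt; apply/negP => yd; apply: (gnc x y c d) => //.
  exact/eqfg.
have [cx xd] : c < x /\ x < d.
  by move: cr; rewrite /crossing; clear -dy; lia.
apply: exists_flip => //; first by clear -cx; lia.
move=> z gxz; rewrite leqNgt; apply/negP=> yz.
apply: (fnc c d x z fcd); first exact/eqfg.
by rewrite /crossing; clear -cx xd yz dy; lia.
Qed.

(** The system obtained when the root of [g], made M-periodic, is replaced by the
    root starting at [a]: [s] stands for the point a + s, and arcs beyond [M]
    are read one period earlier. *)
Definition rebase g (a s t : nat) : Prop :=
  [\/ s = 0 /\ t = M,
      [/\ s < t, a + t <= M & g (a + s) (a + t)]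
    | [/\ s < t, t <= M, M <= a + s & g (a + s - M) (a + t - M)]].

(** The point [a] is the one before [M] in the cell under the root: the leftmost
    a > 0 joined to [M] by an arc of [g] or by a unit step.  Hence every arc of
    [g] other than the root lies on one side of [a].  Maximality persists
    because a further arc would be some (a, M + r) with 0 < r < a: then the gap
    of (r, M) is good, and (r, M) in [g] contradicts the choice of [a]. *)
Lemma exists_root_flip g : admissible 0 M -> max_system g ->
  exists a, [/\ 0 < a, a < M, a.+1 = M \/ g a M,
    forall s t, g s t -> [\/ s = 0 /\ t = M, t <= a | a <= s]
    & max_system (rebase g a)].
Proof.
move=> aroot [gadm gnc gmax]; have [M_gt1 _ dM] := aroot.
have exa : exists a, (0 < a) && ((a == M.-1) || `[< g a M >]).
  by exists M.-1; rewrite eqxx; clear -M_gt1; lia.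
case: (ex_minnP exa) => a /andP [a_gt0 aP] amin.
have {exa amin} amin r : 0 < r -> g r M -> a <= r.
  by move=> r_gt0 h; apply: amin; rewrite r_gt0; apply/orP; right; apply/asboolP.
have {}aP : a.+1 = M \/ g a M.
  by case/orP: aP => [/eqP ->|/asboolP]; [left; rewrite prednK // ltnW|right].
have aM : a < M by case: aP => [<-//|/gadm [h _ _]]; exact: ltnW.
have da : good_gap a M by case: aP => [<-|/gadm []//]; exact: good_gapS.
have gM c d : g c d -> c < d /\ d <= M by move=> /gadm [/ltnW].
have nca s t : g s t -> [\/ s = 0 /\ t = M, t <= a | a <= s].
  move=> gst; have [st tM] := gM _ _ gst.
  have h : t = M -> 0 < s -> a <= s by move=> e s0; apply: amin; rewrite -?e.
  have [ta|ta] := leqP t a; first by apply: Or32.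
  have [as'|as'] := leqP a s; first by apply: Or33.
  apply: Or31; case: aP => [e|gaM].
    by clear -h e st tM ta as'; lia.
  have := gnc _ _ _ _ gst gaM; rewrite /crossing.
  by clear -h st tM ta as'; lia.
exists a; split => //; split.
- move=> s t [[-> ->]|[st tM /gadm [h1 h2 h3]]|[st tM Ms /gadm [h1 h2 h3]]].
  + exact: aroot.
  + split; [clear -h1; lia|clear -tM; lia|].
    by apply: good_gap_eq h3 _; clear; lia.
  + split; [clear -h1; lia|exact: tM|].
    by apply: good_gap_eq h3 _; clear -Ms h1; lia.
- move=> s t s' t' [[-> ->]|[h1 h2 h3]|[h1 h2 h3 h4]]
                   [[-> ->]|[h1' h2' h3']|[h1' h2' h3' h4']]; rewrite /crossing.
  + by clear; lia.
  + by clear -h2'; lia.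
  + by clear -h2'; lia.
  + by clear -h2; lia.
  + by have := gnc _ _ _ _ h3 h3'; rewrite /crossing; clear; lia.
  + by clear -h2 h3'; lia.
  + by clear -h2; lia.
  + by clear -h2' h3; lia.
  + by have := gnc _ _ _ _ h4 h4'; rewrite /crossing; clear -h3 h3' h1 h1'; lia.
move=> s t [st tM dst] ncst.
have nc_lo c d : g c d -> d <= a -> ~ crossing s t (c + M - a) (d + M - a).
  move=> gcd da'; have [cd dM'] := gM _ _ gcd; apply: ncst; apply: Or33.
  have -> : a + (c + M - a) - M = c by clear -aM; lia.
  have -> : a + (d + M - a) - M = d by clear -aM; lia.
  by split=> //; clear -cd da' aM; lia.
have nc_hi c d : g c d -> a <= c -> ~ crossing s t (c - a) (d - a).
  move=> gcd ac; have [cd dM'] := gM _ _ gcd; apply: ncst; apply: Or32.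
  have -> : a + (c - a) = c by clear -ac; lia.
  have -> : a + (d - a) = d by clear -ac cd; lia.
  by split=> //; clear -cd ac; lia.
have [[es et]|nroot] := pselect (s = 0 /\ t = M); first exact: Or31.
have [hi|lo] := leqP (a + t) M.
  apply: Or32; split => //; first by clear -st; lia.
  apply: gmax => [|c d gcd].
    split; [clear -st; lia|exact: hi|].
    by apply: good_gap_eq dst _; clear; lia.
  have [cd dM'] := gM _ _ gcd; rewrite /crossing.
  have h := nc_hi _ _ gcd; rewrite /crossing in h.
  by case: (nca _ _ gcd) => h'; clear -h h' st hi cd; lia.
have [lo2|wrap] := leqP M (a + s).
  apply: Or33; split => //; first by clear -st; lia.
  apply: gmax => [|c d gcd].
    split; [clear -st lo2; lia|clear -tM aM; lia|].
    by apply: good_gap_eq dst _; clear -lo2 st; lia.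
  have [cd dM'] := gM _ _ gcd; rewrite /crossing.
  have h := nc_lo _ _ gcd; rewrite /crossing in h.
  by case: (nca _ _ gcd) => h'; clear -h h' st tM lo2 cd aM; lia.
have s0 : s = 0.
  case: aP => [e|gaM]; first by clear -e wrap; lia.
  have := nc_hi _ _ gaM (leqnn _); rewrite /crossing.
  by clear -lo wrap aM; lia.
subst s.
(* The arc is (a, a + t) with M < a + t, and r = a + t - M. *)
have gr : g (a + t - M) M.
  apply: gmax => [|c d gcd].
    split; [clear -tM nroot aM lo; lia|by []|].
    by apply: (good_gap_exchange da dM dst); clear -aM st lo tM nroot; lia.
  have [cd dM'] := gM _ _ gcd; rewrite /crossing.
  have h := nc_lo _ _ gcd; rewrite /crossing in h.
  by case: (nca _ _ gcd) => h'; clear -h h' lo tM nroot cd aM dM'; lia.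
have r_gt0 : 0 < a + t - M by clear -lo; lia.
by have := amin _ r_gt0 gr; clear -tM nroot lo; lia.
Qed.

End ArcSystems.

Lemma root_admissible m n : 0 < m -> 0 < n -> admissible m (m * n + 1) 0 (m * n + 1).
Proof.
move=> m_gt0 n_gt0; split=> //; last exact: (good_gap_mul m 0 n).
by rewrite addn1 ltnS muln_gt0 m_gt0.
Qed.

(** * Shelling by a numerical key *)

(** The facets sorted by [key] form the shelling: [H] precedes [G] and shares with
    it [G :\ d], a face of codimension one that contains F :&: G.  Descending
    from any facet to such an [H] ends at the first facet, whence purity. *)
Lemma shellable_of_key (V : finType) (K : simplicial_complex V)
    (key : {set V} -> nat) :
  (forall F G, facet K F -> facet K G -> F != G -> key F <= key G ->
     exists d H, [/\ d \in G :\: F, facet K H, key H < key G,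
       G :\ d \subset H & #|H| = #|G|]) ->
  shellable K.
Proof.
move=> exch.
pose leT := relpre key leq.
have leT_tot : total leT by move=> F G; apply: leq_total.
have leT_tr : transitive leT by move=> F G H; apply: leq_trans.
pose s := sort leT (enum [pred F : {set V} | `[< facet K F >]]).
have sP F : F \in s <-> facet K F.
  by rewrite mem_sort mem_enum inE; split=> [/asboolP|h]; last exact/asboolP.
have s_uniq : uniq s by rewrite sort_uniq enum_uniq.
have s_sorted : sorted leT s by apply: sort_sorted.
have key_nth i j : i <= j < size s -> key (nth set0 s i) <= key (nth set0 s j).
  move=> /andP [ij js]; apply: (sorted_leq_nth leT_tr _ set0 s_sorted) => //.
  - by move=> F; apply: leqnn.
  - by rewrite inE (leq_ltn_trans ij).
split; last first.
  exists s; split=> // k /andP [k_gt0 ks] E [[EG [l lk EF]] Emax].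
  set G := nth set0 s k in EG Emax *; set F := nth set0 s l in EF.
  have Gs : facet K G by apply/sP; rewrite mem_nth.
  have ls : l < size s by apply: ltn_trans lk ks.
  have Fs : facet K F by apply/sP; rewrite mem_nth.
  have FG : F != G by rewrite nth_uniq // ltn_eqF.
  have kFG : key F <= key G by apply: key_nth; rewrite ks ltnW.
  have [d [H [/setDP [dG dF] HK kH GH _]]] := exch F G Fs Gs FG kFG.
  have Hs : H \in s by apply/sP.
  have Hk : index H s < k.
    rewrite ltnNge; apply/negP => kle.
    have := @key_nth k (index H s); rewrite kle index_mem Hs nth_index //.
    by move=> /(_ isT); rewrite leqNgt kH.
  have <- : G :\ d = E.
    apply: Emax; last first.
      rewrite subsetD1 EG; apply: contra dF; exact: (subsetP EF).
    split; first exact: subsetDl.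
    by exists (index H s) => //; rewrite nth_index.
  by rewrite /simplex_dim (cardsD1 d G) dG; lia.
have [s0|] := posnP (size s).
  by exists 0%R => F /sP; rewrite (size0nil s0).
move=> s_gt0; exists (simplex_dim (nth set0 s 0)).
suff h n F : key F < n -> facet K F -> simplex_dim F = simplex_dim (nth set0 s 0).
  by move=> F FK; apply: h (ltnSn (key F)) FK.
elim: n F => [//|n IHn] F Fn FK.
have [->//|ne] := eqVneq F (nth set0 s 0).
have G0 : facet K (nth set0 s 0) by apply/sP; rewrite mem_nth.
have k0 : key (nth set0 s 0) <= key F.
  move/sP: (FK) => Fs; rewrite -(nth_index set0 Fs).
  by apply: key_nth; rewrite index_mem.
rewrite eq_sym in ne; have [d [H [_ HK kH _ cH]]] := exch _ _ G0 FK ne k0.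
have <- := IHn H (leq_trans kH Fn) HK.
by rewrite /simplex_dim cH.
Qed.

Section Weight.
Variables (V : finType) (rho : V -> nat).
Implicit Types F G H : {set V}.

(** [rank] refines [rho] to an injective function, breaking ties arbitrarily. *)
Definition rank (x : V) := rho x * #|V| + enum_rank x.

Lemma rank_inj : injective rank.
Proof.
move=> x y; rewrite /rank => e; apply/enum_rank_inj/val_inj => /=.
have := congr1 (modn^~ #|V|) e; rewrite !modnMDl !modn_small //; exact: ltn_ord.
Qed.

Lemma rank_lt x y : rho x < rho y -> rank x < rank y.
Proof.
rewrite /rank => h; apply: leq_trans (leq_addr _ _).
apply: (@leq_trans ((rho x).+1 * #|V|)); last by rewrite leq_mul2r h orbT.
by rewrite mulSnr -addnS leq_add2l.
Qed.

(** Comparing weights is comparing sets lexicographically, elements of high rank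
    first: a power of 2 exceeds any sum of smaller distinct ones. *)
Definition weight F := \sum_(x in F) 2 ^ rank x.

Lemma sum_pow2_lt k F : (forall x, x \in F -> rank x < k) ->
  \sum_(x in F) 2 ^ rank x < 2 ^ k.
Proof.
elim: k F => [|k IHk] F Fk.
  by rewrite big1 // => x /Fk.
have [/existsP [y /andP [yF /eqP yk]]|no] := boolP [exists y, (y \in F) && (rank y == k)].
  rewrite (big_setD1 y) //= yk expnS mul2n -addnn ltn_add2l; apply: IHk.
  move=> x; rewrite !inE => /andP [xy xF]; have := Fk _ xF.
  rewrite ltnS leq_eqVlt => /orP [/eqP e|//].
  by case/eqP: xy; apply: rank_inj; rewrite e yk.
apply: (@leq_trans (2 ^ k)); last by rewrite leq_exp2l.
apply: IHk => x xF; have := Fk _ xF; rewrite ltnS leq_eqVlt => /orP [e|//].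
by case/existsP: no; exists x; rewrite xF.
Qed.

Lemma weight_top F G : F != G -> weight F <= weight G ->
  exists2 d, d \in G :\: F &
    forall e, rho d < rho e -> (e \in F) = (e \in G).
Proof.
move=> FG wFG.
pose S := (F :\: G) :|: (G :\: F).
have [x0 x0S] : exists x, x \in S.
  apply/set0Pn; apply: contra FG => /eqP S0; apply/eqP/setP => x.
  have := in_set0 x; rewrite -S0 !inE.
  by case: (x \in F); case: (x \in G).
case: (arg_maxnP rank x0S) => d dS dmax; have {}dS : d \in S := dS.
have dtop e : rank d < rank e -> (e \in F) = (e \in G).
  move=> de; case: (boolP (e \in S)) => [/dmax /=|]; first by rewrite leqNgt de.
  by rewrite !inE; case: (e \in F); case: (e \in G).
have dlow e : e \in S -> e != d -> rank e < rank d.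
  move=> eS ed; rewrite ltn_neqAle; rewrite (inj_eq rank_inj) ed; exact: dmax eS.
exists d; last by move=> e de; apply/dtop/rank_lt.
have [//|nd] := boolP (d \in G :\: F).
have dFG : d \in F :\: G.
  by move: dS; rewrite /S in_setU (negPf nd) orbF.
have wF : weight F = \sum_(x in F :&: G) 2 ^ rank x + \sum_(x in F :\: G) 2 ^ rank x.
  by rewrite /weight (big_setID G).
have wG : weight G = \sum_(x in F :&: G) 2 ^ rank x + \sum_(x in G :\: F) 2 ^ rank x.
  by rewrite /weight (big_setID F) setIC.
have lt1 : \sum_(x in G :\: F) 2 ^ rank x < 2 ^ rank d.
  apply: sum_pow2_lt => x xGF; apply: dlow; first by rewrite inE xGF orbT.
  by apply: contraTneq xGF => ->; move: dFG; rewrite !inE; case: (d \in F); rewrite ?andbF.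
have lt2 : 2 ^ rank d <= \sum_(x in F :\: G) 2 ^ rank x.
  by rewrite (big_setD1 d) //= leq_addr.
by move: wFG; rewrite wF wG; lia.
Qed.

Lemma weight_exchange G d d' : d \in G -> d' \notin G -> rho d' < rho d ->
  weight (d' |: G :\ d) < weight G.
Proof.
move=> dG d'G lt; rewrite /weight big_setU1 /=; last by rewrite !inE negb_and d'G orbT.
by rewrite [X in _ < X](big_setD1 d) //= ltn_add2r ltn_exp2l // rank_lt.
Qed.

Lemma card_exchange G d d' : d \in G -> d' \notin G -> #|d' |: G :\ d| = #|G|.
Proof.
move=> dG d'G; rewrite cardsU1 (cardsD1 d G) dG !inE negb_and d'G orbT.
by [].
Qed.

End Weight.

(** * Coordinates on the facets containing a given face *)

(** A chart describes the facets containing [base] by arcs of [0, M]: the vertices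
    compatible with [base] are the [arc a b], where (a, b) is not the root.  No
    condition bears on [arc 0 M], so that the root may stand for an edge of the
    polygon, with [base] empty, or for the vertex in [base]. *)
Section Charts.
Variables (V : finType) (vertex : V -> Prop) (compat : V -> V -> Prop).
Variables m M : nat.
Variables (base : {set V}) (arc : nat -> nat -> V).
Local Notation K := (pairwise_complex vertex compat).
Implicit Types F G H : {set V}.

Definition proper_arc a b := admissible m M a b /\ (a, b) <> (0, M).

Record chart : Prop := Chart {
  chart_root : admissible m M 0 M;
  chart_base : pairwise_face vertex compat base;
  chart_vertex : forall a b, proper_arc a b -> vertex (arc a b);
  chart_inj : forall a b c d, proper_arc a b -> proper_arc c d ->
    arc a b = arc c d -> a = c /\ b = d;
  chart_compat : forall a b c d, proper_arc a b -> proper_arc c d ->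
    (a, b) <> (c, d) -> compat (arc a b) (arc c d) <-> ~ crossing a b c d;
  chart_base_arc : forall a b x, proper_arc a b -> x \in base ->
    [/\ arc a b != x, compat (arc a b) x & compat x (arc a b)];
  chart_onto : forall x, vertex x -> x \notin base ->
    (forall y, y \in base -> compat y x) ->
    exists a b, proper_arc a b /\ x = arc a b }.

Definition system G a b : Prop :=
  (a, b) = (0, M) \/ proper_arc a b /\ arc a b \in G.

(** The right endpoint of an arc, read off the vertex that the arc represents. *)
Definition height x := \max_(b < M.+1 | `[< exists a, proper_arc a b /\ x = arc a b >]) b.

Hypothesis ch : chart.

Lemma height_arc a b : proper_arc a b -> height (arc a b) = b.
Proof.
move=> pab; have [[_ bM _] _] := pab.
apply/eqP; rewrite eqn_leq; apply/andP; split.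
  apply/bigmax_leqP => c /asboolP [a' [pa'c e]].
  by have [_ ->] := chart_inj ch pab pa'c e.
have bM' : b < M.+1 by [].
rewrite -[X in X <= _]/(nat_of_ord (Ordinal bM')) /height.
by apply: (@leq_bigmax_cond _ _ _ (Ordinal bM')); apply/asboolP; exists a.
Qed.

Lemma system_admissible G a b : system G a b -> admissible m M a b.
Proof. by case=> [[-> ->]|[[]//]]; exact: chart_root ch. Qed.

(** What charts are for: exchanges of arcs become exchanges of facets. *)
Lemma facet_system G : base \subset G ->
  facet K G <-> (forall x, x \in G -> x \in base \/
                   exists a b, proper_arc a b /\ x = arc a b)
                /\ max_system m M (system G).
Proof.
move=> /subsetP baseG.
have root_nc a b c d : system G a b -> (c, d) = (0, M) -> ~ crossing a b c d.
  move=> /system_admissible [_ h _] [-> ->]; rewrite /crossing; clear -h; lia.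
have nc_root a b c d : system G a b -> (c, d) = (0, M) -> ~ crossing c d a b.
  move=> /system_admissible [_ h _] [-> ->]; rewrite /crossing; clear -h; lia.
split=> [[[Gv Gc] Gmax]|[Gel [sadm snc smax]]].
- have Gel x : x \in G -> x \in base \/ exists a b, proper_arc a b /\ x = arc a b.
    move=> xG; have [xb|xb] := boolP (x \in base); first by left.
    right; apply: (chart_onto ch) => //; first exact: Gv.
    by move=> y yb; apply: Gc => //; [exact: baseG|apply: contraNneq xb => <-].
  split=> //; split; first exact: system_admissible.
    move=> a b c d sab scd; case: (sab) => [e|[pab abG]]; first exact: nc_root.
    case: (scd) => [e|[pcd cdG]]; first exact: root_nc.
    have [[-> ->]|ne] := pselect ((a, b) = (c, d)); first exact: crossing_irr.
    apply/(chart_compat ch) => //; apply: Gc => //.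
    by apply/eqP => /(chart_inj ch pab pcd) [ea eb]; apply: ne; rewrite ea eb.
  move=> a b aab nc; have [e|ne] := pselect ((a, b) = (0, M)); first by left.
  right; have pab : proper_arc a b by split.
  split=> //; suff <- : arc a b |: G = G by rewrite setU11.
  apply: Gmax; last exact: subsetUr.
  have comp y : y \in G -> y != arc a b -> compat (arc a b) y /\ compat y (arc a b).
    move=> yG ya; have [yb|[c [d [pcd ey]]]] := Gel _ yG.
      by have [] := chart_base_arc ch pab yb.
    have scd : system G c d by right; rewrite -ey.
    have ne' : (a, b) <> (c, d) by case=> ea eb; case/eqP: ya; rewrite ey ea eb.
    have := nc _ _ scd; rewrite ey => h.
    split; apply/(chart_compat ch) => //; first by move=> e; apply: ne'; rewrite e.
    by move: h; rewrite /crossing; clear; lia.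
  split=> [x /setU1P [->|/Gv //]|x y]; first exact: (chart_vertex ch).
  move=> /setU1P [->|xG] /setU1P [->|yG] xy.
  + by rewrite eqxx in xy.
  + by rewrite eq_sym in xy; case: (comp _ yG xy).
  + by case: (comp _ xG xy).
  + exact: Gc.
have arc_arc a b c d : system G a b -> proper_arc a b -> system G c d ->
    proper_arc c d -> arc a b != arc c d -> compat (arc a b) (arc c d).
  move=> sab pab scd pcd ne; apply/(chart_compat ch) => //; last exact: snc.
  by move=> [ea eb]; case/eqP: ne; rewrite ea eb.
split.
  split=> [x /Gel [|[a [b [pab ->]]]]|x y xG yG xy].
  - by case: (chart_base ch) => h _; apply: h.
  - exact: (chart_vertex ch).
  case: (Gel _ xG) (Gel _ yG) => [xb|[a [b [pab ex]]]] [yb|[c [d [pcd ey]]]].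
  - by case: (chart_base ch) => _; apply.
  - by rewrite ey; case: (chart_base_arc ch pcd xb).
  - by rewrite ex; case: (chart_base_arc ch pab yb).
  - rewrite ex ey; rewrite ex ey in xG yG xy.
    by apply: arc_arc => //; right.
move=> G' [G'v G'c] GG'; apply/eqP; rewrite eqEsubset GG' andbT.
apply/subsetP=> x xG'; have [xb|xb] := boolP (x \in base); first exact: baseG.
have [a [b [pab ex]]] : exists a b, proper_arc a b /\ x = arc a b.
  apply: (chart_onto ch) => //; first exact: G'v.
  move=> y yb; apply: G'c => //; last by apply: contraNneq xb => <-.
  exact/(subsetP GG')/baseG.
suff : system G a b.
  by case=> [e|[_]]; [case: pab => _ /(_ e)|rewrite -ex].
apply: smax => [|c d scd]; first by case: pab.
case: (scd) => [[-> ->]|[pcd cdG]].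
  by case: pab => [[_ h _] _]; rewrite /crossing; clear -h; lia.
have [[-> ->]|ne] := pselect ((a, b) = (c, d)); first exact: crossing_irr.
apply/(chart_compat ch) => //; rewrite -ex; apply: G'c => //.
  exact: (subsetP GG').
rewrite ex; apply/eqP => /(chart_inj ch pab pcd) [ea eb]; apply: ne.
by rewrite ea eb.
Qed.

Lemma facet_replace G x y v u : base \subset G -> facet K G ->
    proper_arc x y -> arc x y \in G -> v < x -> x < u -> u < y ->
    max_system m M (replace_arc (system G) x y v u) ->
  let H := arc v u |: G :\ arc x y in
  [/\ arc v u \notin G, height (arc v u) < height (arc x y),
      base \subset H & facet K H].
Proof.
move=> bG GK pxy xyG vx xu uy rM H.
have pvu : proper_arc v u.
  split; first by case: rM => h _ _; apply: h; right.
  by case: pxy => [[_ yM _] _] []; clear -uy yM; lia.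
have [Gel [_ snc _]] := proj1 (facet_system bG) GK.
have vuG : arc v u \notin G.
  apply/negP=> vuG; apply: (snc v u x y); [by right|by right|].
  by left.
have bH : base \subset H.
  apply/subsetP => z zb; rewrite in_setU1 in_setD1 (subsetP bG _ zb) andbT.
  by case: (chart_base_arc ch pxy zb) => ne _ _; rewrite eq_sym in ne; rewrite ne orbT.
split=> //; first by rewrite !height_arc.
apply/(facet_system bH); split.
  move=> z; rewrite in_setU1 in_setD1 => /orP [/eqP ->|/andP [_ /Gel //]].
  by right; exists v, u.
apply: eq_max_system rM => a b; split.
- case=> [[[e|[pab abG]] ne]|[-> ->]]; first by left.
    right; split=> //; rewrite in_setU1 in_setD1 abG andbT; apply/orP; right.
    by apply/eqP => /(chart_inj ch pab pxy) [ea eb]; apply: ne; rewrite ea eb.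
  by right; rewrite in_setU1 eqxx.
- case=> [e|[pab]].
    by left; split; [left|rewrite e; case: pxy => _ ne e'; apply: ne].
  rewrite in_setU1 in_setD1 => /orP [/eqP /(chart_inj ch pab pvu) [-> ->]|].
    by right.
  case/andP=> ne abG; left; split; first by right.
  by move=> [ea eb]; case/eqP: ne; rewrite ea eb.
Qed.

Lemma facet_exchange F G d : base \subset F -> base \subset G ->
    facet K F -> facet K G -> d \in G :\: F ->
    (forall e, height d < height e -> (e \in F) = (e \in G)) ->
  exists d', [/\ d' \notin G, height d' < height d,
                 base \subset d' |: G :\ d & facet K (d' |: G :\ d)].
Proof.
move=> bF bG FK GK /setDP [dG dF] top.
have [_ Fs] := proj1 (facet_system bF) FK.
have [Gel Gs] := proj1 (facet_system bG) GK.
have [db|[x [y [pxy ed]]]] := Gel _ dG.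
  by case/negP: dF; apply: (subsetP bF).
have sxy : system G x y by right; rewrite -ed.
have nxy : ~ system F x y.
  by case=> [e|[_]]; [case: pxy => _ /(_ e)|rewrite -ed; apply/negP].
have [|v [u [vx xu uy rM]]] := exists_flip_of_top Fs Gs sxy nxy.
  move=> a b yb.
  have [e|ne] := pselect ((a, b) = (0, M)); first by split=> _; left.
  have h : proper_arc a b -> (arc a b \in F) = (arc a b \in G).
    by move=> pab; apply: top; rewrite ed !height_arc.
  by split=> -[//|[pab abF]]; right; split=> //; rewrite ?h // -h.
exists (arc v u); rewrite ed in dG *.
by apply: facet_replace.
Qed.

End Charts.

(** * Cyclic position on a polygon *)

Section Steps.
Variable N : nat.
Implicit Types i j k l : 'I_N.

Lemma stepsE i k : steps i k = if i <= k then k - i else k + N - i.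
Proof.
rewrite /steps; have := ltn_ord i; have := ltn_ord k => kN iN.
case: leqP => ik.
  rewrite (_ : k + (N - i) = k - i + N) ?modnDr ?modn_small //; lia.
rewrite addnBA ?modn_small //; lia.
Qed.

Lemma ltn_steps i k : steps i k < N.
Proof. by rewrite /steps ltn_mod (leq_trans _ (ltn_ord i)). Qed.

Lemma steps_eq0 i k : (steps i k == 0) = (i == k).
Proof.
rewrite stepsE; have iN := ltn_ord i; apply/eqP/eqP => [e|->].
  by apply: val_inj => /=; move: e; case: leqP; lia.
by rewrite leqnn subnn.
Qed.

Lemma steps_inj i : injective (steps i).
Proof.
move=> k l; rewrite !stepsE => e; apply: val_inj => /=; move: e.
have iN := ltn_ord i; have kN := ltn_ord k; have lN := ltn_ord l.
by case: (leqP i k); case: (leqP i l); lia.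
Qed.

(** Exactly one of [k], [l] lies strictly inside the arc from [i] to [j], and the
    other one strictly outside. *)
Definition interlaced i j k l : Prop :=
  (0 < steps i k < steps i j /\ steps i j < steps i l) \/
  (0 < steps i l < steps i j /\ steps i j < steps i k).

Lemma card_boundary_arc i j : #|boundary_arc i j| = (steps i j).+1.
Proof.
have N_gt0 : 0 < N by apply: leq_ltn_trans (ltn_ord i).
pose f (s : 'I_(steps i j).+1) : 'I_N := Ordinal (ltn_pmod (i + s) N_gt0).
have fs s : steps i (f s) = s.
  have sN : s < N by apply: leq_ltn_trans (ltn_steps i j); rewrite -ltnS.
  rewrite /steps /= modnDml (_ : i + s + (N - i) = s + N) ?modnDr ?modn_small //.
  by have := ltn_ord i; lia.
have f_inj : injective f.
  by move=> s t e; apply: val_inj; rewrite /= -fs e fs.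
have -> : boundary_arc i j = [set f s | s : 'I_(steps i j).+1].
  apply/setP => k; rewrite inE; apply/idP/imsetP => [ks|[s _ ->]].
    have ks' : steps i k < (steps i j).+1 by [].
    by exists (Ordinal ks') => //; apply: (@steps_inj i); rewrite fs.
  by rewrite fs -ltnS.
by rewrite card_imset // card_ord.
Qed.

Hypothesis N_gt0 : 0 < N.

(** Polygon vertices are indexed by natural numbers modulo [N], so that arcs can
    be written (a, b) with a < b even when they pass through vertex 0. *)
Definition pt a : 'I_N := Ordinal (ltn_pmod a N_gt0).

Lemma ptK (i : 'I_N) : pt i = i.
Proof. by apply: val_inj; rewrite /= modn_small. Qed.

Lemma ptDN a : pt (a + N) = pt a.
Proof. by apply: val_inj; rewrite /= modnDr. Qed.

Lemma steps_pt a s : steps (pt a) (pt (a + s)) = s %% N.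
Proof.
rewrite /steps /= modnDml.
have h := ltn_pmod a N_gt0.
rewrite (_ : a + s + (N - a %% N) = a %/ N * N + (s + N)).
  by rewrite modnMDl modnDr.
by have := divn_eq a N; lia.
Qed.

Lemma steps_ptE a b : a <= b -> b < a + N -> steps (pt a) (pt b) = b - a.
Proof. by move=> ab h; rewrite -{1}(subnKC ab) steps_pt modn_small //; lia. Qed.

Lemma steps_ptV a b : b <= a -> a <= b + N ->
  steps (pt a) (pt b) = if a == b then 0 else b + N - a.
Proof.
move=> ba h; have [->|ne] := eqVneq a b.
  by apply/eqP; rewrite steps_eq0.
by rewrite -(ptDN b) -{1}(@subnKC a (b + N)) // steps_pt modn_small //; lia.
Qed.

Lemma steps_pt_small a b : a < N -> b < N ->
  steps (pt a) (pt b) = if a <= b then b - a else b + N - a.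
Proof. by move=> aN bN; rewrite stepsE /= !modn_small. Qed.

Lemma pt_eq p a b : pt (p + a) = pt (p + b) -> a = b %[mod N].
Proof. by move/(congr1 (steps (pt p))); rewrite !steps_pt. Qed.

Lemma pt_neq a b : a < b -> b < a + N -> pt a != pt b.
Proof.
move=> ab bN; rewrite -steps_eq0 steps_ptE //; last exact: ltnW.
by rewrite subn_eq0 -ltnNge.
Qed.

Lemma pt_steps a k : k = pt (a + steps (pt a) k).
Proof.
by apply: (@steps_inj (pt a)); rewrite steps_pt modn_small // ltn_steps.
Qed.

Lemma is_diagonal_pt a b : a.+1 < b -> b.+1 < a + N -> is_diagonal (pt a) (pt b).
Proof.
move=> ab ba; have N_gt1 : 1 < N by clear -ab ba; lia.
have st (i : 'I_N) : steps i (ordS i) = 1.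
  have -> : ordS i = pt (i + 1) by apply: val_inj; rewrite /= addn1.
  by rewrite -{1}(ptK i) steps_pt modn_small.
rewrite /is_diagonal pt_neq ?(ltnW ab) ?(ltnW ba) //=.
apply/norP; split; apply/eqP => e.
  have := st (pt a); rewrite -e steps_ptE; clear -ab ba; lia.
have := st (pt b); rewrite -e steps_ptV; clear -ab ba; try lia.
by case: eqP; lia.
Qed.

Lemma set2_pt_eq a b c d : a < b < N -> c < d < N ->
  [set pt a; pt b] = [set pt c; pt d] -> a = c /\ b = d.
Proof.
move=> abN cdN e.
have inj x y : x < N -> y < N -> pt x = pt y -> x = y.
  by move=> xN yN /(congr1 val); rewrite /= !modn_small.
have : pt a \in [set pt c; pt d] by rewrite -e !inE eqxx.
have : pt b \in [set pt c; pt d] by rewrite -e !inE eqxx orbT.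
by rewrite !inE => /orP [] /eqP /inj h1 /orP [] /eqP /inj h2; lia.
Qed.

Lemma ptDmul a (k : nat) : pt (a + k * N) = pt a.
Proof. by apply: val_inj; rewrite /= addnC modnMDl. Qed.

Lemma steps_shift p a b : steps (pt (p + a)) (pt (p + b)) = steps (pt a) (pt b).
Proof.
have ab : a <= b + a * N by rewrite (leq_trans (leq_pmulr a N_gt0)) ?leq_addl.
rewrite -(ptDmul (p + b) a) -(ptDmul b a) -addnA -(subnKC ab) addnA.
by rewrite !steps_pt.
Qed.

Lemma interlaced_shift p a b c d :
  interlaced (pt (p + a)) (pt (p + b)) (pt (p + c)) (pt (p + d)) <->
  interlaced (pt a) (pt b) (pt c) (pt d).
Proof. by rewrite /interlaced !steps_shift. Qed.

Lemma iter_ordS_pt a (k : nat) : iter k (@ordS N) (pt a) = pt (a + k).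
Proof.
elim: k => [|k IHk]; first by rewrite addn0.
by apply: val_inj; rewrite iterS IHk addnS /= -addn1 modnDml addn1.
Qed.

End Steps.

(** * Crossing diagonals of a convex polygon *)

Section Convex.
Local Open Scope ring_scope.
Variables (R : realFieldType) (N : nat) (P : 'I_N -> 'rV[R]_2).
Hypothesis convexP : convex_polygon P.
Implicit Types i j k l : 'I_N.

Lemma orientation_cycle (a b c : 'rV[R]_2) : orientation a b c = orientation b c a.
Proof. by rewrite /orientation; ring. Qed.

Lemma orientation_swap (a b c : 'rV[R]_2) : orientation a b c = - orientation a c b.
Proof. by rewrite /orientation; ring. Qed.

(** Orientation is invariant under cyclic shifts, so three vertices met in
    anticlockwise order may be listed in increasing order. *)
Lemma orientation_gt0 i j k : (0 < steps i j)%N -> (steps i j < steps i k)%N ->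
  0 < orientation (P i) (P j) (P k).
Proof.
rewrite !stepsE; have iN := ltn_ord i; have jN := ltn_ord j; have kN := ltn_ord k.
case: (leqP i j) => ij; case: (leqP i k) => ik h1 h2.
- by apply: convexP; apply/andP; split; clear -ij h1 h2; lia.
- rewrite -orientation_cycle; apply: convexP; clear -ij h1 h2 ik; lia.
- clear -ij ik h2 kN; lia.
- by rewrite orientation_cycle; apply: convexP; clear -ij ik h1 h2; lia.
Qed.

Lemma orientation_lt0 i j k : (0 < steps i k)%N -> (steps i k < steps i j)%N ->
  orientation (P i) (P j) (P k) < 0.
Proof. by move=> h1 h2; rewrite orientation_swap oppr_lt0 orientation_gt0. Qed.

Lemma in_relint_set2 i j x : i != j -> in_relint P [set i; j] x ->
  exists2 t : R, 0 < t < 1 & x = (1 - t) *: P i + t *: P j.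
Proof.
move=> ij [i' [j' [e ne [t /andP [t0 t1] ex]]]].
have : i' \in [set i; j] by rewrite e !inE eqxx.
have : j' \in [set i; j] by rewrite e !inE eqxx orbT.
rewrite !inE => /orP [/eqP ej|/eqP ej] /orP [/eqP ei|/eqP ei]; subst i' j'.
- by rewrite eqxx in ne.
- exists (1 - t); first by apply/andP; split; lra.
  by rewrite opprB addrCA subrr addr0 addrC.
- by exists t; rewrite ?t0.
- by rewrite eqxx in ne.
Qed.

(** The affine form [f], whose zero set is the line through [P i] and [P j],
    vanishes at the common point of the two segments.  Hence [f] takes opposite
    signs at [P k] and [P l], or vanishes at both, and the latter makes the two
    diagonals equal. *)
Lemma cross_interlaced i j k l : i != j -> k != l -> [set i; j] != [set k; l] ->
  cross P [set i; j] [set k; l] -> interlaced i j k l.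
Proof.
move=> ij kl ne [x /(in_relint_set2 ij) [t _ ex] /(in_relint_set2 kl) [s s01 ex']].
pose f y := orientation (P i) (P j) y.
have fx : f x = 0 by rewrite ex /f /orientation !mxE; ring.
have {fx} fkl : (1 - s) * f (P k) + s * f (P l) = 0.
  by rewrite -fx ex' /f /orientation !mxE; ring.
have sgn h : [\/ h = i \/ h = j, (0 < steps i h < steps i j)%N /\ f (P h) < 0
                | (steps i j < steps i h)%N /\ 0 < f (P h)].
  have [e|ih] := eqVneq i h; first by apply: Or31; left.
  have h0 : (0 < steps i h)%N by rewrite lt0n steps_eq0.
  have [lt|gt|e] := ltngtP (steps i h) (steps i j).
  - by apply: Or32; rewrite h0; split=> //; apply: orientation_lt0.
  - by apply: Or33; split=> //; apply: orientation_gt0 => //; rewrite lt0n steps_eq0.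
  - by apply: Or31; right; apply: steps_inj e.
have fi : f (P i) = 0 by rewrite /f /orientation; ring.
have fj : f (P j) = 0 by rewrite /f /orientation; ring.
have f0 h : h = i \/ h = j -> f (P h) = 0 by case=> ->.
case/andP: s01 => s0 s1; have {}s1 : 0 < 1 - s by rewrite subr_gt0.
case: (sgn k) => [ek|[hk fk]|[hk fk]]; case: (sgn l) => [el|[hl fl]|[hl fl]].
- case/eqP: ne; case: ek el kl => -> [] -> //; first by rewrite eqxx.
    by rewrite setUC.
  by rewrite eqxx.
- by move: fkl; rewrite (f0 k) // mulr0 add0r; have := pmulr_rlt0 (f (P l)) s0; lra.
- by move: fkl; rewrite (f0 k) // mulr0 add0r; have := pmulr_rgt0 (f (P l)) s0; lra.
- by move: fkl; rewrite (f0 l) // mulr0 addr0; have := pmulr_rlt0 (f (P k)) s1; lra.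
- have h1 : (1 - s) * f (P k) < 0 by rewrite pmulr_rlt0.
  have h2 : s * f (P l) < 0 by rewrite pmulr_rlt0.
  by clear -h1 h2 fkl; lra.
- by left; rewrite hk.
- by move: fkl; rewrite (f0 l) // mulr0 addr0; have := pmulr_rgt0 (f (P k)) s1; lra.
- by right; rewrite hl.
- have h1 : 0 < (1 - s) * f (P k) by rewrite pmulr_rgt0.
  have h2 : 0 < s * f (P l) by rewrite pmulr_rgt0.
  by clear -h1 h2 fkl; lra.
Qed.

(** Four points in convex position satisfy the affine relation
    ga P_i + de P_j = al P_k + be P_l whose coefficients are twice the areas of
    the triangles they span; these are positive, and dividing by
    ga + de = al + be gives the intersection point. *)
Lemma interlaced_cross i j k l : interlaced i j k l ->
  cross P [set i; j] [set k; l].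
Proof.
wlog [/andP [k0 kj] jl] : k l / (0 < steps i k < steps i j)%N /\ (steps i j < steps i l)%N.
  move=> wl [h|h]; first by apply: wl => //; left.
  by rewrite (setUC [set k]); apply: wl => //; left.
move=> _.
pose al := orientation (P i) (P j) (P l); pose be := orientation (P i) (P k) (P j).
pose ga := orientation (P k) (P j) (P l); pose de := orientation (P i) (P k) (P l).
have al_gt0 : 0 < al by apply: orientation_gt0 => //; apply: ltn_trans k0 kj.
have be_gt0 : 0 < be by apply: orientation_gt0.
have de_gt0 : 0 < de by apply: orientation_gt0 => //; apply: ltn_trans kj jl.
have ga_gt0 : 0 < ga.
  have iN := ltn_ord i; have jN := ltn_ord j; have kN := ltn_ord k; have lN := ltn_ord l.
  apply: orientation_gt0; move: k0 kj jl; rewrite !stepsE; clear -iN jN kN lN.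
    by case: (leqP i k); case: (leqP i j); case: (leqP i l); case: (leqP k j); lia.
  by case: (leqP i k); case: (leqP i j); case: (leqP i l); case: (leqP k j);
    case: (leqP k l); lia.
have e : al + be = ga + de by rewrite /al /be /ga /de /orientation; ring.
have eP : ga *: P i + de *: P j = al *: P k + be *: P l.
  apply/rowP => c; rewrite !mxE.
  have [->|->] : c = 0 \/ c = 1.
    by case: c => [[|[|//]] ?]; [left|right]; apply: val_inj.
  - by rewrite /al /be /ga /de /orientation; ring.
  - by rewrite /al /be /ga /de /orientation; ring.
have ij : i != j by rewrite -steps_eq0 -lt0n (ltn_trans k0).
have kl : k != l by apply: contraTneq jl => <-; rewrite -leqNgt ltnW.
pose D := ga + de; have D_gt0 : 0 < D by rewrite addr_gt0.
have D0 : D != 0 by rewrite gt_eqF.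
exists (D^-1 *: (ga *: P i + de *: P j)).
  exists i, j; split=> //; exists (de / D).
    by rewrite divr_gt0 // ltr_pdivrMr // mul1r ltrDr.
  have -> : 1 - de / D = ga / D by rewrite /D; field.
  by rewrite scalerDr !scalerA ![D^-1 * _]mulrC.
exists k, l; split=> //; exists (be / D).
  by rewrite divr_gt0 // ltr_pdivrMr // mul1r /D -e ltrDr.
have -> : 1 - be / D = al / D.
  by rewrite -[1](divff D0) -mulrBl {1}/D -e addrK.
by rewrite eP scalerDr !scalerA ![D^-1 * _]mulrC.
Qed.

Lemma crossE i j k l : i != j -> k != l -> [set i; j] != [set k; l] ->
  cross P [set i; j] [set k; l] <-> interlaced i j k l.
Proof. by move=> ij kl ne; split; [exact: cross_interlaced|exact: interlaced_cross]. Qed.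

End Convex.

(** * Type A *)

Section TypeA.
Variables (R : realFieldType) (m n : nat) (m_gt0 : 0 < m) (n_gt0 : 0 < n).
Local Notation N := (m * n + 2).
Local Notation M := (m * n + 1).
Variables (P : 'I_N -> 'rV[R]_2) (convexP : convex_polygon P).

Lemma A_polygon_gt0 : 0 < N. Proof. by rewrite addn2. Qed.
Local Notation pt := (pt A_polygon_gt0).

Definition A_arc a b : {set 'I_N} := [set pt a; pt b].

(** The root is here the polygon edge joining the vertices 0 and M, which is no
    vertex of the complex; every diagonal of the complex is an arc. *)
Lemma A_chart : chart (@A_vertex m n) (fun d e => ~ cross P d e) m M set0 A_arc.
Proof.
have ltM a b : proper_arc m M a b -> a < b < N.
  by case=> -[ab bM _] _; clear -ab bM; lia.
have inj a b c d : proper_arc m M a b -> proper_arc m M c d ->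
    A_arc a b = A_arc c d -> a = c /\ b = d.
  by move=> /ltM h1 /ltM h2; apply: set2_pt_eq.
split=> //.
- exact: root_admissible.
- exact: pairwise_face0.
- move=> a b [[ab bM gab] ne]; exists (pt a), (pt b).
  have ne' : a <> 0 \/ b <> M.
    by case: (eqVneq a 0) => [ea|/eqP]; [right=> eb; apply: ne; rewrite ea eb|left].
  have [k ek] := good_gapP (ltnW ab) gab.
  split=> //; first by apply: is_diagonal_pt; clear -ab bM ne'; lia.
  have k_gt0 : 0 < k by case: k ek ab => // ->; clear; rewrite muln0; lia.
  have kn : k < n.
    rewrite -(ltn_pmul2l m_gt0); clear -ek bM ne'; lia.
  exists k; first by clear -k_gt0 kn; lia.
  rewrite !card_boundary_arc steps_ptE ?steps_ptV; try by clear -ab bM; lia.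
  rewrite gtn_eqF; last by clear -ab; lia.
  have := mulnBr m n k; have := leq_mul (leqnn m) (ltnW kn); clear -ek; lia.
- move=> a b c d pab pcd ne.
  have h1 := ltM _ _ pab; have h2 := ltM _ _ pcd.
  suff -> : cross P (A_arc a b) (A_arc c d) <-> crossing a b c d by [].
  rewrite /A_arc crossE //.
  + rewrite /interlaced !steps_pt_small; try (clear -h1 h2; lia).
    rewrite /crossing; move: ne.
    by case: (leqP a b); case: (leqP a c); case: (leqP a d); clear -h1 h2; lia.
  + by apply: pt_neq; clear -h1; lia.
  + by apply: pt_neq; clear -h2; lia.
  + by apply/eqP => /(inj _ _ _ _ pab pcd) [ea eb]; apply: ne; rewrite ea eb.
- by move=> a b x _; rewrite inE.
move=> d [i [j [_ -> [k /andP [k_gt0 kn] [card_ij _]]]]] _ _.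
move: card_ij; rewrite card_boundary_arc stepsE => e.
have iN := ltn_ord i; have jN := ltn_ord j.
have kn' : k < n by clear -n_gt0 kn; lia.
have mk : m <= m * k by rewrite leq_pmulr.
have mkn : m * k + m <= m * n by rewrite -mulnSr leq_mul2l kn' orbT.
have A_arcE (i' j' : 'I_N) : A_arc i' j' = [set i'; j'] by rewrite /A_arc !ptK.
move: e; case: leqP => ij e.
- exists i, j; rewrite A_arcE; split=> //; split.
    split; [clear -m_gt0 mk e; lia|clear -jN; lia|].
    by have -> : j = i + (m * k + 1) :> nat by [clear -e ij; lia]; exact: good_gap_mul.
  by move=> [e1 e2]; clear -e e1 e2 mkn m_gt0; lia.
- exists j, i; rewrite A_arcE setUC; split=> //; split.
    split; [clear -m_gt0 mkn e iN jN; lia|clear -iN; lia|].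
    have -> : i = j + (m * (n - k) + 1) :> nat; last exact: good_gap_mul.
    by rewrite mulnBr; clear -e ij mkn iN; lia.
  by move=> [e1 e2]; clear -e e1 e2 mk m_gt0; lia.
Qed.

Lemma shellable_A : shellable (Delta_A m n P).
Proof.
pose h := height m M A_arc.
apply: (@shellable_of_key _ _ (weight h)) => F G FK GK FG wFG.
have [d dGF top] := weight_top FG wFG.
have [d' [d'G hd _ HK]] :=
  facet_exchange A_chart (sub0set _) (sub0set _) FK GK dGF top.
have dG : d \in G by case/setDP: dGF.
exists d, (d' |: G :\ d); split=> //.
- exact: weight_exchange.
- exact: subsetUr.
- exact: card_exchange.
Qed.

End TypeA.

(** * Type B *)

Section TypeB.
Variables (R : realFieldType) (m n : nat) (m_gt0 : 0 < m) (n_gt0 : 0 < n).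
Local Notation N := (2 * m * n + 2).
Local Notation M := (m * n + 1).
Variables (P : 'I_N -> 'rV[R]_2) (convexP : convex_polygon P).

Lemma B_polygon_gt0 : 0 < N. Proof. by rewrite addn2. Qed.
Local Notation pt := (pt B_polygon_gt0).

Lemma sizeB : N = M + M.
Proof. by clear; lia. Qed.

Implicit Types F G H : {set {set {set 'I_N}}}.

Definition chord a b : {set 'I_N} := [set pt a; pt b].
Definition B_arc a b : {set {set 'I_N}} := diagonal_pair (pt a) (pt b).

Lemma antipode_pt a : antipode (pt a) = pt (a + M).
Proof.
have half_N : N./2 = M by rewrite (congr1 half sizeB) addnn doubleK.
by rewrite /antipode iter_ordS_pt half_N.
Qed.

Lemma B_arcE a b : B_arc a b = [set chord a b; chord (a + M) (b + M)].
Proof. by rewrite /B_arc /diagonal_pair !antipode_pt. Qed.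

Lemma ptD2M a : pt (a + M + M) = pt a.
Proof. by rewrite -addnA -sizeB ptDN. Qed.

Lemma B_arc_antipode a b : B_arc (a + M) (b + M) = B_arc a b.
Proof. by rewrite !B_arcE setUC /chord !ptD2M. Qed.

Lemma B_arcDmul a b k : B_arc (a + k * M) (b + k * M) = B_arc a b.
Proof.
elim: k => [|k IHk]; first by rewrite !addn0.
by rewrite -IHk -(B_arc_antipode (a + k * M)) (mulSnr k M) !addnA.
Qed.

(** Distinct B-diagonals therefore share no diagonal, and [crossE], which is about
    distinct diagonals, applies to their members. *)
Lemma B_arc_mem a b d : d \in B_arc a b ->
  B_arc a b = [set d; (@antipode N) @: d].
Proof.
have mate x y : (@antipode N) @: chord x y = chord (x + M) (y + M).
  by rewrite /chord imsetU !imset_set1 !antipode_pt.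
rewrite B_arcE !inE => /orP [] /eqP ->; rewrite mate //.
by rewrite setUC /chord !ptD2M.
Qed.

Lemma B_noncrossing_arcs a b c d : a < b <= a + M -> c < d <= c + M ->
    B_arc a b <> B_arc c d ->
  B_noncrossing P (B_arc a b) (B_arc c d) <->
  ~ interlaced (pt a) (pt b) (pt c) (pt d) /\
  ~ interlaced (pt a) (pt b) (pt (c + M)) (pt (d + M)).
Proof.
move=> abM cdM ne.
have chord_cross x y z t : chord x y \in B_arc a b -> chord z t \in B_arc c d ->
    x < y <= x + M -> z < t <= z + M ->
    cross P (chord x y) (chord z t) <-> interlaced (pt x) (pt y) (pt z) (pt t).
  move=> xyD ztE h1 h2; have N2 := sizeB.
  apply: crossE => //; first by apply: pt_neq; clear -h1 N2; lia.
    by apply: pt_neq; clear -h2 N2; lia.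
  apply/eqP => e; apply: ne; rewrite (B_arc_mem xyD) (B_arc_mem ztE).
  by rewrite (e : chord x y = chord z t).
have D1 : chord a b \in B_arc a b by rewrite B_arcE !inE eqxx.
have D2 : chord (a + M) (b + M) \in B_arc a b by rewrite B_arcE !inE eqxx orbT.
have E1 : chord c d \in B_arc c d by rewrite B_arcE !inE eqxx.
have E2 : chord (c + M) (d + M) \in B_arc c d by rewrite B_arcE !inE eqxx orbT.
have abM' : a + M < b + M <= a + M + M by rewrite ltn_add2r leq_add2r.
have cdM' : c + M < d + M <= c + M + M by rewrite ltn_add2r leq_add2r.
have shiftM x y z t : interlaced (pt (x + M)) (pt (y + M)) (pt (z + M)) (pt (t + M)) <->
    interlaced (pt x) (pt y) (pt z) (pt t).
  by rewrite !(addnC _ M); apply: interlaced_shift.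
split=> [nc|[nc1 nc2] D E].
  by split=> h; [apply: (nc _ _ D1 E1)|apply: (nc _ _ D1 E2)]; apply/chord_cross.
rewrite !B_arcE !inE => /orP [] /eqP -> /orP [] /eqP -> /chord_cross h.
- exact/nc1/h.
- exact/nc2/h.
- apply: nc2; apply/shiftM; rewrite !ptD2M; exact: h.
- by apply: nc1; apply/shiftM; apply: h.
Qed.

(** The antipodal copy of an arc of the window [p, p + M] lies in [p + M, p + 2M]
    and crosses no arc of the window; what remains is crossing of intervals. *)
Lemma B_noncrossing_window p a b c d : a < b <= M -> c < d <= M ->
    B_arc (p + a) (p + b) <> B_arc (p + c) (p + d) ->
  B_noncrossing P (B_arc (p + a) (p + b)) (B_arc (p + c) (p + d)) <->
  ~ crossing a b c d.
Proof.
move=> abM cdM ne; rewrite B_noncrossing_arcs //; try (clear -abM cdM; lia).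
rewrite -!addnA !interlaced_shift.
have N2 := sizeB; have ltM x : x <= M -> x < N by clear -N2; lia.
have -> : interlaced (pt a) (pt b) (pt c) (pt d) <-> crossing a b c d.
  rewrite /interlaced !steps_pt_small; try (apply: ltM; clear -abM cdM; lia).
  rewrite /crossing.
  by case: (leqP a b); case: (leqP a c); case: (leqP a d); clear -abM cdM N2; lia.
suff h : ~ interlaced (pt a) (pt b) (pt (c + M)) (pt (d + M)) by split=> [[]|].
have stab : steps (pt a) (pt b) = b - a.
  by apply: steps_ptE; clear -abM N2; lia.
have stc : steps (pt a) (pt (c + M)) = c + M - a.
  by apply: steps_ptE; clear -abM cdM N2; lia.
rewrite /interlaced stab stc.
have [lt|le] := ltnP (d + M) (a + N).
  by rewrite steps_ptE //; clear -abM cdM N2 lt; lia.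
have -> : pt (d + M) = pt a.
  rewrite (_ : d + M = a + N) ?ptDN //; clear -abM cdM N2 le; lia.
have /eqP -> : steps (pt a) (pt a) == 0 by rewrite steps_eq0.
by clear -abM cdM; lia.
Qed.

Lemma B_arc_diameter p : B_arc p (p + M) = [set [set pt p; antipode (pt p)]].
Proof. by rewrite B_arcE /chord antipode_pt ptD2M (setUC [set pt (p + M)]) setUid. Qed.

(** A B-diagonal that does not fit in the window [p, p + M] runs across its end,
    and crosses the diameter there. *)
Lemma B_cross_diameter p s t : 0 < s -> s < M -> M < t -> t <= s + M ->
  B_arc p (p + M) <> B_arc (p + s) (p + t) /\
  ~ B_noncrossing P (B_arc p (p + M)) (B_arc (p + s) (p + t)).
Proof.
move=> s_gt0 sM Mt tM; have N2 := sizeB.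
have ne : B_arc p (p + M) <> B_arc (p + s) (p + t).
  move=> e; have : chord (p + s) (p + t) \in B_arc p (p + M).
    by rewrite e B_arcE !inE eqxx.
  rewrite B_arc_diameter inE antipode_pt => /eqP /setP /(_ (pt (p + s))).
  rewrite !inE eqxx => /esym /orP [] /eqP.
    rewrite -{2}(addn0 p) => /pt_eq; rewrite !modn_small; clear -s_gt0 sM N2; lia.
  by move/pt_eq; rewrite !modn_small; clear -s_gt0 sM N2; lia.
split=> //; have h := @B_noncrossing_arcs p (p + M) (p + s) (p + t).
move/h => [||//|nc _]; try (clear -sM Mt tM; lia).
apply: nc; rewrite -{1}(addn0 p); apply/interlaced_shift; left.
rewrite !steps_ptE; try (clear -s_gt0 sM Mt tM N2; lia).
Qed.

Lemma B_arc_inj p a b c d : a < b <= M -> c < d <= M ->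
  B_arc (p + a) (p + b) = B_arc (p + c) (p + d) -> a = c /\ b = d.
Proof.
move=> abM cdM e; have N2 := sizeB.
have : chord (p + a) (p + b) \in B_arc (p + c) (p + d).
  by rewrite -e B_arcE !inE eqxx.
have eqN x y : pt (p + x) = pt (p + y) -> x < N -> y < N -> x = y.
  by move=> /pt_eq h xN yN; rewrite !modn_small in h.
have eqN' x y : pt (p + x) = pt (p + y + M) -> x <= M -> y <= M ->
    x = y + M \/ x = 0 /\ y = M.
  rewrite -addnA => /pt_eq h xM yM; move: h; rewrite modn_small; last by clear -xM N2; lia.
  have [lt|ge] := ltnP (y + M) N; first by rewrite modn_small // => ->; left.
  rewrite (_ : y + M = N) ?modnn; last by clear -N2 yM ge; lia.
  by move=> x0; right; clear -N2 yM ge x0; lia.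
rewrite B_arcE !inE /chord => /orP [] /eqP h.
  have : pt (p + a) \in [set pt (p + c); pt (p + d)] by rewrite -h !inE eqxx.
  have : pt (p + b) \in [set pt (p + c); pt (p + d)] by rewrite -h !inE eqxx orbT.
  rewrite !inE => /orP [] /eqP /eqN h1 /orP [] /eqP /eqN h2;
    by clear -abM cdM N2 h1 h2; lia.
have : pt (p + a) \in [set pt (p + c + M); pt (p + d + M)] by rewrite -h !inE eqxx.
have : pt (p + b) \in [set pt (p + c + M); pt (p + d + M)] by rewrite -h !inE eqxx orbT.
rewrite !inE => /orP [] /eqP /eqN' h1 /orP [] /eqP /eqN' h2;
  by clear -abM cdM N2 h1 h2; lia.
Qed.

(** The vertices of the central polygon form two disjoint boundary arcs, each
    running from the end of one diagonal to the start of its antipode, and are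
    counted there. *)
Lemma B_arc_vertex x k : 1 <= k <= n -> B_vertex P (B_arc x (x + (m * k + 1))).
Proof.
move=> /andP [k_gt0 kn]; set l := m * k + 1.
have mkn : m * k <= m * n by rewrite leq_mul2l kn orbT.
have mk : m <= m * k by rewrite leq_pmulr.
have l1 : 1 < l by rewrite /l; clear -mk m_gt0; lia.
have lM : l <= M by rewrite /l; clear -mkn; lia.
have N2 := sizeB.
have cardM : m * (n - k) + 1 = M - l + 1 by rewrite mulnBr /l; clear -mkn; lia.
have st a s : s < N -> steps (pt a) (pt (a + s)) = s.
  by move=> sN; rewrite steps_pt modn_small.
split.
  have [e|ltM] : l = M \/ l < M by clear -lM; lia.
    by left; exists (pt x); rewrite e B_arc_diameter.
  right; exists (pt x), (pt (x + l)); split=> //.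
    by apply: is_diagonal_pt; clear -l1 ltM N2; lia.
  rewrite !antipode_pt => /cross_interlaced h.
  have neN y s : 0 < s -> s < N -> pt y != pt (y + s).
    by move=> s_gt0 sN; apply: pt_neq; clear -s_gt0 sN; lia.
  have neM : pt (x + M) != pt (x + l + M).
    by rewrite addnAC; apply: neN; clear -l1 ltM N2; lia.
  have ne0 : pt x != pt (x + l) by apply: neN; clear -l1 lM N2; lia.
  have ne1 : pt x != pt (x + M) by apply: neN; clear -l1 lM N2; lia.
  have ne2 : pt x != pt (x + l + M) by rewrite -addnA; apply: neN; clear -l1 ltM N2; lia.
  have ne : [set pt x; pt (x + l)] != [set pt (x + M); pt (x + l + M)].
    apply/eqP => /setP /(_ (pt x)).
    by rewrite !inE eqxx (negPf ne1) (negPf ne2).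
  move: (h convexP ne0 neM ne).
  rewrite /interlaced -addnA !st; try (clear -l1 ltM N2; lia).
exists (pt x), (pt (x + l)); split=> //; exists k; first by rewrite k_gt0.
have lN : l < N by clear -lM N2; lia.
have eI : pt x = pt (x + l + (N - l)).
  by rewrite -addnA subnKC ?ptDN // ltnW.
have eI2 : pt x = pt (x + l + M + (M - l)).
  by rewrite addnAC -(addnA x) subnKC // ptD2M.
have eI' : pt (x + M) = pt (x + l + (M - l)) by rewrite -addnA subnKC.
have eI2' : pt (x + M) = pt (x + l + M + (N - l)).
  by rewrite addnAC -(addnA x) subnKC ?(ltnW lN) // addnAC ptDN.
have stM s : s < N -> steps (pt (x + l + M)) (pt (x + l + s)) =
    if M <= s then s - M else s + M.
  move=> sN; case: leqP => Ms.
    by rewrite -{1}(subnKC Ms) (addnA (x + l) M) st //; clear -sN; lia.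
  rewrite -(ptD2M (x + l + s)) (_ : x + l + s + M + M = x + l + M + (s + M)).
    by rewrite st //; clear -Ms N2; lia.
  by clear; lia.
have s1 : steps (pt (x + l)) (pt x) = N - l by rewrite eI st //; clear -l1 lN; lia.
have s2 : steps (pt (x + l + M)) (pt x) = M - l by rewrite eI2 st //; clear -l1 lN N2; lia.
have s3 : steps (pt (x + l)) (pt (x + M)) = M - l.
  by rewrite eI' st //; clear -l1 lN N2; lia.
have s4 : steps (pt (x + l + M)) (pt (x + M)) = N - l.
  by rewrite eI2' st //; clear -l1 lN; lia.
have el : l + 1 = m * k + 2 by rewrite /l; clear; lia.
rewrite !antipode_pt !card_boundary_arc; split.
- by rewrite st // -el addn1.
- by rewrite addnAC st // -el addn1.
have zE z : z = pt (x + l + steps (pt (x + l)) z) by apply: pt_steps.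
have -> : boundary_arc (pt (x + l)) (pt x) :&: boundary_arc (pt (x + l + M)) (pt (x + M)) =
    boundary_arc (pt (x + l)) (pt (x + M)) :|: boundary_arc (pt (x + l + M)) (pt x).
  apply/setP => z; rewrite !inE s1 s2 s3 s4.
  have := ltn_steps (pt (x + l)) z; rewrite {3 5}(zE z).
  set s := steps _ _ => sN; rewrite stM //.
  by case: (leqP M s) => sM; clear -sM sN N2 l1 lM; lia.
rewrite cardsU (_ : _ :&: _ = set0) ?cards0 ?subn0.
  rewrite !card_boundary_arc s2 s3; move: cardM; rewrite -mulnA; clear; lia.
apply/setP => z; rewrite !inE s2 s3.
have := ltn_steps (pt (x + l)) z; rewrite {3}(zE z).
set s := steps _ _ => sN; rewrite stM //.
by case: (leqP M s) => sM; clear -sM sN N2 l1 lM; lia.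
Qed.

(** Translation by M does not change a B-diagonal, so its starting point can be
    brought into any window of length M. *)
Lemma B_vertex_arc p D : B_vertex P D ->
  exists s k, [/\ s < M, 1 <= k <= n & D = B_arc (p + s) (p + s + (m * k + 1))].
Proof.
move=> [_ [i [j [-> [k kn [card_ij _ _]]]]]].
have M_gt0 : 0 < M by rewrite addn1.
have st : steps i j = m * k + 1 by move: card_ij; rewrite card_boundary_arc; clear; lia.
have -> : diagonal_pair i j = B_arc i (i + (m * k + 1)).
  have ej := pt_steps B_polygon_gt0 i j; rewrite ptK st in ej.
  by rewrite /B_arc ptK -ej.
have pz : p <= i + p * M by rewrite (leq_trans (leq_pmulr p M_gt0)) ?leq_addl.
exists ((i + p * M - p) %% M), k; split=> //; first by rewrite ltn_mod.
rewrite -(B_arcDmul i _ p) -[in RHS](B_arcDmul _ _ ((i + p * M - p) %/ M)).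
have e : p + (i + p * M - p) %% M + (i + p * M - p) %/ M * M = i + p * M.
  by have := divn_eq (i + p * M - p) M; clear -pz; lia.
by rewrite (addnAC _ (m * k + 1) (_ %/ _ * _)) e (addnAC _ _ (p * _)).
Qed.

Definition diameter p := B_arc p (p + M).

Local Notation compat := (B_noncrossing P).

(** Here the root is the diameter starting at [p]. *)
Lemma B_chart p :
  chart (B_vertex P) compat m M [set diameter p] (fun a b => B_arc (p + a) (p + b)).
Proof.
have lt a b : proper_arc m M a b -> a < b <= M.
  by case=> [[ab bM _] _]; clear -ab bM; lia.
have diam0 : diameter p = B_arc (p + 0) (p + M) by rewrite addn0.
have M0 : 0 < M <= M by rewrite addn1 leqnn.
have diam_vertex : B_vertex P (diameter p).
  by apply: B_arc_vertex; rewrite n_gt0 leqnn.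
have ne_diam a b : proper_arc m M a b -> B_arc (p + a) (p + b) <> diameter p.
  rewrite diam0 => pab /(B_arc_inj (lt _ _ pab) M0) [ea eb].
  by case: pab => _; rewrite ea eb.
split.
- exact: root_admissible.
- split=> [x /set1P -> //|x y /set1P -> /set1P ->]; by rewrite eqxx.
- move=> a b pab; have := lt _ _ pab; case: pab => [[ab bM gab] _] abM.
  have [|k e] := good_gapP _ gab; first by clear -ab; lia.
  rewrite e addnA; apply: B_arc_vertex; apply/andP; split.
    by case: k e => // e; move: ab; rewrite e muln0; clear; lia.
  by rewrite -(leq_pmul2l m_gt0); move: bM; rewrite e; clear; lia.
- by move=> a b c d /lt abM /lt cdM; apply: B_arc_inj.
- move=> a b c d /lt abM /lt cdM ne; apply: B_noncrossing_window => //.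
  by move=> /(B_arc_inj abM cdM) [ea eb]; apply: ne; rewrite ea eb.
- move=> a b x pab /set1P ->; have := ne_diam _ _ pab; have abM := lt _ _ pab.
  move=> ne; split; first exact/eqP.
    rewrite diam0 in ne *; apply/B_noncrossing_window => //.
    by rewrite /crossing; clear -abM; lia.
  rewrite diam0 in ne *; apply/B_noncrossing_window => //; first exact: nesym.
  by rewrite /crossing; clear -abM; lia.
move=> D /(B_vertex_arc p) [s [k [sM /andP [k_gt0 kn] ->]]] /set1P ne nc.
have {nc} nc := nc _ (set11 _).
have mk : m <= m * k by rewrite leq_pmulr.
have mkn : m * k <= m * n by rewrite leq_mul2l kn orbT.
rewrite -addnA in ne nc *.
have [le|gt] := leqP (s + (m * k + 1)) M.
  exists s, (s + (m * k + 1)); split=> //; split.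
    split=> //; first by clear -mk m_gt0; lia.
    exact: good_gap_mul.
  by move=> [es el]; apply: ne; rewrite /diameter el es addn0.
have [||||_ /(_ nc)//] := @B_cross_diameter p s (s + (m * k + 1)); try by [].
- by clear -gt mkn; lia.
- by clear -mkn; lia.
Qed.

(** Start at the origin [x] of a longest arc of [G].  An arc of [G] crossing the
    diameter at [x] passes over [x], up to a translation by M; not crossing the
    longest arc, it strictly contains it, and is longer. *)
Lemma compatible_diameter G : pairwise_face (B_vertex P) compat G ->
  exists x, forall D, D \in G -> D != diameter x ->
    compat D (diameter x) /\ compat (diameter x) D.
Proof.
move=> [Gv Gc]; have N2 := sizeB.
pose Q l := `[< exists x, 0 < l <= M /\ B_arc x (x + l) \in G >].
have window x s l D : D = B_arc (x + s) (x + s + l) -> 0 < l -> s + l <= M ->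
    D != diameter x -> compat D (diameter x) /\ compat (diameter x) D.
  move=> -> l_gt0 slM ne.
  have M0 : 0 < M <= M by rewrite addn1 leqnn.
  have sl : s < s + l <= M by clear -l_gt0 slM; lia.
  have diam0 : diameter x = B_arc (x + 0) (x + M) by rewrite addn0.
  move/eqP: ne; rewrite diam0 -addnA => ne.
  split; apply/B_noncrossing_window => //; try exact: nesym.
    by rewrite /crossing; clear -sl; lia.
  by rewrite /crossing; clear -sl; lia.
have Q_arc x s k D : D = B_arc (x + s) (x + s + (m * k + 1)) -> D \in G ->
    1 <= k <= n -> Q (m * k + 1).
  move=> -> DG /andP [_ kn]; apply/asboolP; exists (x + s); split=> //.
  by apply/andP; split; rewrite !addn1 // ltnS leq_mul2l kn orbT.
have [exQ|noQ] := pselect (exists l, Q l); last first.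
  exists 0 => D DG _; have [s [k [_ kn eD]]] := B_vertex_arc 0 (Gv _ DG).
  by case: noQ; exists (m * k + 1); apply: Q_arc eD DG kn.
have Qle l : Q l -> l <= M by move=> /asboolP [x [/andP []]].
case: (ex_maxnP exQ Qle) => l /asboolP [x [/andP [l_gt0 lM] EG]] lmax.
exists x => D DG ne; have [s [k [sM kn eD]]] := B_vertex_arc x (Gv _ DG).
have := Q_arc _ _ _ _ eD DG kn => /lmax l'l.
set l' := m * k + 1 in eD l'l.
have l'_gt0 : 0 < l' by rewrite /l' addn1.
have [le|gt] := leqP (s + l') M; first exact: window eD l'_gt0 le ne.
have [eDE|neE] := eqVneq D (B_arc x (x + l)).
  by apply: (window x 0 l) => //; rewrite addn0.
have nc := Gc _ _ DG EG neE; move: nc; rewrite eD => nc.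
have sl' : x + s < x + s + l' <= x + s + M by clear -l'_gt0 l'l lM; lia.
have xl : x < x + l <= x + M by clear -l_gt0 lM; lia.
rewrite eD in neE; have [h _] := B_noncrossing_arcs sl' xl (elimN eqP neE).
case: (h nc) => _ []; left; rewrite -!addnA.
rewrite !steps_ptE; clear -gt sM l'_gt0 l'l lM l_gt0 N2; lia.
Qed.

Lemma facet_diameter G : facet (pairwise_complex (B_vertex P) compat) G ->
  exists2 p, p < M & diameter p \in G.
Proof.
move=> [Gf Gmax]; have [x xG] := compatible_diameter Gf; have [Gv Gc] := Gf.
have diam_vertex : B_vertex P (diameter x).
  by apply: B_arc_vertex; rewrite n_gt0 leqnn.
exists (x %% M); first by rewrite ltn_mod addn1.
have -> : diameter (x %% M) = diameter x.
  have e : x %% M + x %/ M * M = x by rewrite addnC -divn_eq.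
  by rewrite /diameter -(B_arcDmul (x %% M) _ (x %/ M)) (addnAC _ M) e.
suff <- : diameter x |: G = G by rewrite setU11.
apply: Gmax; last exact: subsetUr.
split=> [D /setU1P [-> //|/Gv //]|D E].
move=> /setU1P [->|DG] /setU1P [->|EG] DE.
- by rewrite eqxx in DE.
- by rewrite eq_sym in DE; case: (xG _ EG DE).
- by case: (xG _ DG DE).
- exact: Gc.
Qed.

Local Notation K := (pairwise_complex (B_vertex P) compat).
Local Notation B_system p := (system m M (fun a b => B_arc (p + a) (p + b))).

Lemma diameter_antipode p : diameter (p + M) = diameter p.
Proof. exact: B_arc_antipode. Qed.

Lemma facet_diameter_cross G p s t : facet K G -> diameter p \in G ->
  0 < s -> s < M -> M < t -> t <= s + M -> B_arc (p + s) (p + t) \notin G.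
Proof.
move=> [[_ Gc] _] pG s_gt0 sM Mt tM; apply/negP => h.
have [ne nc] := B_cross_diameter p s_gt0 sM Mt tM.
by apply: nc; apply: Gc => //; apply/eqP.
Qed.

(** The facet counterpart of [exists_root_flip]: in the chart at [p + a] the new
    set is the rebased system.  An arc of the new chart passing over the end of
    the old window crosses the old diameter, hence does not come from [G]. *)
Lemma facet_diameter_flip G p a : facet K G -> diameter p \in G -> 0 < a < M ->
    (forall s t, B_system p G s t -> [\/ s = 0 /\ t = M, t <= a | a <= s]) ->
    max_system m M (rebase M (B_system p G) a) ->
  facet K (diameter (p + a) |: G :\ diameter p).
Proof.
move=> GK pG /andP [a_gt0 aM] cover rM.
set H := _ |: _.
have bG : [set diameter p] \subset G by rewrite sub1set.
have bH : [set diameter (p + a)] \subset H by rewrite sub1set setU11.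
have [Gel _] := proj1 (facet_system (B_chart p) bG) GK.
have shift s : a + (s + M - a) = s + M by clear -aM; lia.
have diam0 q : diameter q = B_arc (q + 0) (q + M) by rewrite addn0.
have M0 : 0 < M <= M by rewrite addn1 leqnn.
have ne_diam q s t : s < t <= M -> (s, t) <> (0, M) -> B_arc (q + s) (q + t) <> diameter q.
  by rewrite diam0 => st ne /(B_arc_inj st M0) [es et]; apply: ne; rewrite es et.
have [radm _ _] := rM.
have rebase_proper s t : rebase M (B_system p G) a s t -> (s, t) <> (0, M) ->
    proper_arc m M s t.
  by move=> /radm st ne; split.
have pG0 s t : proper_arc m M s t -> B_arc (p + s) (p + t) \in G -> B_system p G s t.
  by move=> pst h; right.
apply/(facet_system (B_chart (p + a)) bH); split.
  move=> D; rewrite in_setU1 in_setD1 => /orP [/eqP ->|]; first by left; rewrite inE.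
  case/andP=> ne DG; right; case: (Gel _ DG) => [/set1P e|[s [t [pst eD]]]].
    by rewrite e eqxx in ne.
  have gst : B_system p G s t by right; rewrite -eD.
  have [[st tM gap] nst] := pst.
  case: (cover _ _ gst) => [[es et]|ta|as_].
  - by case: nst; rewrite es et.
  - exists (s + M - a), (t + M - a); split; last first.
      by rewrite -!addnA !shift (addnA p s) (addnA p t) B_arc_antipode eD.
    split; [split|].
    + by clear -st aM; lia.
    + by clear -ta aM; lia.
    + by apply: good_gap_eq gap _; clear -aM; lia.
    + by move=> [e1 e2]; clear -e1 aM; lia.
  - exists (s - a), (t - a); split; last first.
      by rewrite -!addnA !subnKC //; clear -as_ st; lia.
    split; [split|].
    + by clear -st as_; lia.
    + by clear -tM; lia.
    + by apply: good_gap_eq gap _; clear -as_; lia.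
    + by move=> [e1 e2]; clear -e2 tM a_gt0 M0; lia.
apply: eq_max_system rM => s t; split.
- move=> rst; have [[-> ->]|ne] := pselect ((s, t) = (0, M)); first by left.
  right; split; first exact: rebase_proper.
  rewrite in_setU1 in_setD1; apply/orP; right; rewrite -!addnA.
  case: rst => [[es et]|[st tM]|[st tM Ms]].
  + by case: ne; rewrite es et.
  + case=> [[e _]|[pst ->]]; first by clear -e a_gt0; lia.
    rewrite andbT; apply/eqP; apply: ne_diam.
      by clear -st tM; lia.
    by move=> [e _]; clear -e a_gt0; lia.
  + case=> [[e e']|[pst h]]; first by clear -e e' tM aM Ms; lia.
    have e1 : a + s = (a + s - M) + M by rewrite subnK.
    have e2 : a + t = (a + t - M) + M by rewrite subnK //; clear -Ms st; lia.
    rewrite e1 e2 (addnA p (a + s - M)) (addnA p (a + t - M)) B_arc_antipode h andbT.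
    apply/eqP; apply: ne_diam.
      by clear -st tM Ms aM; lia.
    by move=> [_ e]; clear -e tM aM Ms st; lia.
- case=> [[-> ->]|[pst]]; first by apply: Or31.
  have [[st tM gap] ne] := pst.
  have st' : s < t <= M by clear -st tM; lia.
  rewrite in_setU1 in_setD1 => /orP [/eqP e|/andP [/eqP nD DG]].
    by case: (ne_diam _ _ _ st' ne e).
  rewrite -!addnA in nD DG.
  have [atM|Mat] := leqP (a + t) M.
    apply: Or32; split=> //; first by clear -st; lia.
    apply: pG0 => //; split; last by move=> [e _]; clear -e a_gt0; lia.
    split=> //; first by clear -st; lia.
    by apply: good_gap_eq gap _; clear; lia.
  have [Mas|asM] := leqP M (a + s).
    apply: Or33; split=> //; first by clear -st; lia.
    have e1 : a + s = (a + s - M) + M by rewrite subnK.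
    have e2 : a + t = (a + t - M) + M by rewrite subnK //; clear -Mat; lia.
    rewrite e1 e2 (addnA p (a + s - M)) (addnA p (a + t - M)) B_arc_antipode in DG.
    apply: pG0 => //; split; last by move=> [_ e]; clear -e tM aM Mat; lia.
    split; [clear -st Mas; lia|clear -tM aM; lia|].
    by apply: good_gap_eq gap _; clear -Mas st; lia.
  have as_gt0 : 0 < a + s by clear -a_gt0; lia.
  have atM : a + t <= a + s + M by clear -tM; lia.
  by have := facet_diameter_cross GK pG as_gt0 asM Mat atM; rewrite DG.
Qed.

(** Since the least origin is taken, exhibiting a diameter in a set bounds its
    index from above. *)
Definition diameter_index (G : {set {set {set 'I_N}}}) :=
  find (fun p => diameter p \in G) (iota 0 M).

Lemma diameter_index_le G p : p < M -> diameter p \in G -> diameter_index G <= p.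
Proof.
move=> pM pG; rewrite leqNgt; apply/negP => /(before_find 0).
by rewrite nth_iota // add0n pG.
Qed.

Lemma diameter_indexP G : facet K G ->
  diameter_index G < M /\ diameter (diameter_index G) \in G.
Proof.
move=> /facet_diameter [p pM pG].
have lt : diameter_index G < M by exact: leq_ltn_trans (diameter_index_le pM pG) pM.
have hasG : has (fun q => diameter q \in G) (iota 0 M).
  by apply/hasP; exists p; rewrite ?mem_iota.
by split=> //; have := nth_find 0 hasG; rewrite nth_iota // add0n.
Qed.

Definition B_weight p := weight (height m M (fun a b => B_arc (p + a) (p + b))).

Definition B_weight_bound :=
  (\max_(p < M) \max_(G : {set {set {set 'I_N}}}) B_weight p G).+1.

(** The lexicographic pair of the diameter and of the weight in its chart, coded
    as one number with digits below [B_weight_bound]. *)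
Definition B_key G := diameter_index G * B_weight_bound + B_weight (diameter_index G) G.

Lemma B_weight_lt p G : p < M -> B_weight p G < B_weight_bound.
Proof.
move=> pM; rewrite ltnS; apply: leq_trans (leq_bigmax (Ordinal pM)).
exact: (leq_bigmax (F := B_weight p)).
Qed.

Lemma leq_B_key F G : facet K F -> facet K G -> B_key F <= B_key G ->
  diameter_index F < diameter_index G \/
  diameter_index F = diameter_index G /\
    B_weight (diameter_index G) F <= B_weight (diameter_index G) G.
Proof.
move=> /diameter_indexP [FM _] /diameter_indexP [GM _]; rewrite /B_key.
have [|GF|->] := ltngtP (diameter_index F) (diameter_index G); first by left.
  have := B_weight_lt G GM; have : (diameter_index G).+1 * B_weight_bound <=
    diameter_index F * B_weight_bound by rewrite leq_mul2r GF orbT.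
  by rewrite mulSn; clear; lia.
by rewrite leq_add2l; right.
Qed.

Lemma ltn_B_key p G H : diameter_index G = p -> p < M -> diameter p \in H ->
  B_weight p H < B_weight p G -> B_key H < B_key G.
Proof.
move=> eG pM pH wHG; rewrite /B_key eG.
have := diameter_index_le pM pH; rewrite leq_eqVlt => /orP [/eqP ->|lt].
  by rewrite ltn_add2l.
have := B_weight_lt H (ltn_trans lt pM).
have : (diameter_index H).+1 * B_weight_bound <= p * B_weight_bound.
  by rewrite leq_mul2r lt orbT.
by rewrite mulSn; clear; lia.
Qed.

Lemma ltn_B_key_index G H : facet K H -> facet K G ->
  diameter_index H < diameter_index G -> B_key H < B_key G.
Proof.
move=> HK GK lt; rewrite ltnNge; apply/negP => /(leq_B_key GK HK) [gt|[e _]].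
  by move: lt; rewrite ltnNge ltnW.
by rewrite e ltnn in lt.
Qed.

Lemma shellable_B : shellable (Delta_B m n P).
Proof.
apply: (@shellable_of_key _ _ B_key) => F G FK GK FG kFG.
have [FM Fp] := diameter_indexP FK; have [GM Gp] := diameter_indexP GK.
set p := diameter_index G in GM Gp.
have bG : [set diameter p] \subset G by rewrite sub1set.
case: (leq_B_key FK GK kFG) => [lt|[e wFG]].
  set q := diameter_index F in FM Fp lt.
  have [_ Gs] := proj1 (facet_system (B_chart p) bG) GK.
  have [a [a_gt0 aM aP cover rM]] := exists_root_flip (root_admissible m_gt0 n_gt0) Gs.
  (* Either the diameter at p + a starts at p + a - M < p, or
     q < p + a < q + M < p + M, so that (p + a, p + M) crosses (q, q + M). *)
  have [wrap|stay] := leqP M (p + a).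
    have aM' : 0 < a < M by rewrite a_gt0.
    have HK := facet_diameter_flip GK Gp aM' cover rM.
    have ed : diameter (p + a) = diameter (p + a - M).
      by rewrite -[in LHS](subnK wrap) diameter_antipode.
    set H := _ |: _ in HK.
    have ltH : diameter_index H < diameter_index G.
      apply: (@leq_ltn_trans (p + a - M)); last first.
        by rewrite -/p; clear -aM wrap GM; lia.
      apply: diameter_index_le; first by clear -aM GM; lia.
      by rewrite -ed setU11.
    have pa : diameter (p + a) \notin G.
      have -> : diameter (p + a) = B_arc (p + a) (p + (a + M)) by rewrite (addnA p a).
      by apply: facet_diameter_cross GK Gp _ _ _ _ => //; clear -a_gt0; lia.
    exists (diameter p), H; split=> //.
    - rewrite in_setD Gp andbT.
      have -> : diameter p = B_arc (q + (p - q)) (q + (p - q + M)).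
        by rewrite (addnA q (p - q)) subnKC // ltnW.
      by apply: facet_diameter_cross FK Fp _ _ _ _ => //; clear -lt GM; lia.
    - exact: ltn_B_key_index.
    - exact: subsetUr.
    - exact: card_exchange.
  (* The last side is not a unit step, as the point q + M lies strictly inside. *)
  have aM1 : a.+1 <> M by clear -stay lt; lia.
  have gaM : B_system p G a M by case: aP.
  have [paM inG] : proper_arc m M a M /\ B_arc (p + a) (p + M) \in G.
    by case: gaM => [[e]|//]; rewrite e in a_gt0.
  have [|v [u [vx xu uy xM]]] := exists_flip Gs gaM a_gt0.
    by move=> z [[e _]|[[[_ zM _] _] _]]; [rewrite e in a_gt0|].
  have [nG hd bH HK] := facet_replace (B_chart p) bG GK paM inG vx xu uy xM.
  exists (B_arc (p + a) (p + M)), (B_arc (p + v) (p + u) |: G :\ B_arc (p + a) (p + M)).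
  split=> //.
  - rewrite in_setD inG andbT.
    have -> : p + a = q + (p - q + a) by clear -lt; lia.
    have -> : p + M = q + (p - q + M) by clear -lt; lia.
    by apply: facet_diameter_cross FK Fp _ _ _ _ => //; clear -lt stay aM; lia.
  - apply: (ltn_B_key (erefl p)) => //; first by rewrite -sub1set.
    exact: weight_exchange.
  - exact: subsetUr.
  - exact: card_exchange.
have bF : [set diameter p] \subset F by rewrite sub1set /p -e.
have [d dGF top] := weight_top FG wFG.
have [d' [d'G hd bH HK]] :=
  facet_exchange (B_chart p) bF bG FK GK dGF top.
have dG : d \in G by case/setDP: dGF.
exists d, (d' |: G :\ d); split=> //.
- apply: (ltn_B_key (erefl p)) => //; first by rewrite -sub1set.
  exact: weight_exchange.
- exact: subsetUr.
- exact: card_exchange.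
Qed.

End TypeB.

(** * Shellability in both types *)

Local Open Scope ring_scope.

Theorem theorem1p4 (R : realFieldType) (m n : nat)
    (hm : (1 <= m)%N) (hn : (1 <= n)%N) :
  (forall P : 'I_(m * n + 2) -> 'rV[R]_2,
     convex_polygon P -> shellable (Delta_A m n P)) /\
  (forall P : 'I_(2 * m * n + 2) -> 'rV[R]_2,
     convex_polygon P -> centrally_symmetric P -> shellable (Delta_B m n P)).
Proof.
split=> P convexP; first exact: shellable_A.
move=> _; exact: shellable_B.
Qed.
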